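(* Let $0<p<1$, $\sigma^2=p(1-p)$, and let $x\in\mathbb{Z}_+$ be fixed. Let $h_t(x)$ be the height function of oriented digital boiling with parameter $p$ and corner initialization. Let $B(t)=(B_0(t),\dots,B_x(t))$ be standard $(x+1)$-dimensional Brownian motion and $$M_x=\max\left\{B_0(t_0)+\big(B_1(t_1)-B_1(t_0)\big)+\dots+\big(B_x(t_x)-B_x(t_{x-1})\big):\ 0\le t_0\le t_1\le\dots\le t_x=1\right\}.$$ Then, as $t\to\infty$, $$\frac{h_t(x)-p\,t}{\sigma\sqrt t}\longrightarrow M_x\quad\text{in distribution}.$$
   Context: Oriented digital boiling (ODB) with parameter $p$ and corner initialization: a random height function $h_t:\mathbb{Z}_+\to\mathbb{Z}_+\cup\{-\infty\}$, $t=0,1,2,\dots$ (where $\mathbb{Z}_+=\{0,1,2,\dots\}$), with $h_0(0)=0$, $h_0(x)=-\infty$ for $x\ge1$, the convention $h_t(-1)=-\infty$ (and $-\infty+1=-\infty$), evolving as follows. If $h_t(x-1)>h_t(x)$ then $h_{t+1}(x)=h_t(x-1)$. Otherwise, independently of all other sites and times, $h_{t+1}(x)=h_t(x)+1$ with probability $p$ and $h_{t+1}(x)=h_t(x)$ with probability $1-p$. Equivalently $h_{t}(x)=\max\{h_{t-1}(x-1),\,h_{t-1}(x)+\epsilon_{x,t}\}$ with $\epsilon_{x,t}$ i.i.d. Bernoulli($p$). Standard $(x+1)$-dimensional Brownian motion starts at $0$ and has independent standard one-dimensional Brownian motions as components. *)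

(* Defs.v *)
From HB Require Import structures.
From mathcomp Require Import all_boot all_order all_algebra.
From mathcomp Require Import all_classical all_reals all_analysis.
From mathcomp Require Import measurable_realfun.

Set Implicit Arguments.
Unset Strict Implicit.
Unset Printing Implicit Defensive.

Import Order.TTheory GRing.Theory Num.Theory.
Import numFieldNormedType.Exports.

Local Open Scope classical_set_scope.
Local Open Scope ring_scope.

Section Probability.
Context {R : realType} {d : measure_display} {T : measurableType d}.
Variable P : probability T R.

Definition mutually_independent (I : choiceType) (F : I -> set_system T) :=
  forall (s : seq I) (A : I -> set T), uniq s ->
    (forall i, i \in s -> F i (A i)) ->
    P (\bigcap_(i in [set` s]) A i) = (\big[*%E/1]_(i <- s) P (A i))%E.

Definition rv_sigma_algebra d' (T' : measurableType d') (X : T -> T') :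
    set_system T :=
  preimage_set_system setT X measurable.

Definition process_sigma_algebra (W : R -> T -> R) : set_system T :=
  <<s \bigcup_(t in [set t | 0 <= t]) rv_sigma_algebra (W t) >>.

Definition iid_bernoulli (p : R) (eps : nat -> nat -> {RV P >-> bool}) :=
  (forall t x, distribution P (eps t x) = bernoulli_prob p
                 :> (set bool -> \bar R)) /\
  mutually_independent
    (fun tx : nat * nat => rv_sigma_algebra (eps tx.1 tx.2)).

(* The second argument of [normal_prob] is the standard deviation. Only the
   times [t >= 0] are relevant. *)
Definition brownian_motion (W : R -> T -> R) :=
  [/\ forall t, 0 <= t -> measurable_fun setT (W t),
      forall w, W 0 w = 0,
      forall w, {within `[0, +oo[, continuous (W ^~ w)},
      forall s t, 0 <= s < t -> forall A, measurable A ->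
        P ((W t \- W s) @^-1` A) = normal_prob 0 (Num.sqrt (t - s)) A &
      forall t : nat -> R, 0 <= t 0%N -> nondecreasing_seq t ->
        mutually_independent
          (fun i => rv_sigma_algebra (W (t i.+1) \- W (t i)))].

Definition brownian_motion_dim (n : nat) (B : 'I_n -> R -> T -> R) :=
  (forall i, brownian_motion (B i)) /\
  mutually_independent (fun i => process_sigma_algebra (B i)).

End Probability.

(* Convergence of distribution functions at the continuity points of that of
   the (real-valued) limit; the [X n] may be defined on another probability
   space and may take the values [-oo] and [+oo]. *)
Definition cvg_in_distribution {R : realType} {d d' : measure_display}
    {T : measurableType d} {T' : measurableType d'}
    (P : probability T R) (X : nat -> T -> \bar R)
    (P' : probability T' R) (Y : T' -> R) :=
  [/\ forall n, measurable_fun setT (X n),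
      measurable_fun setT Y &
      forall r : R,
        {for r, continuous (fun s => P' [set w | Y w <= s])} ->
        P [set w | (X n w <= r%:E)%E] @[n --> \oo] --> P' [set w | Y w <= r]].

Section OrientedDigitalBoiling.
Context {R : realType}.

(* Heights lie in {0, 1, ...} U {-oo}, seen inside the extended reals. *)
Definition odb_init (x : nat) : \bar R := if x is 0%N then 0%E else -oo%E.

Definition odb_left (h : nat -> \bar R) (x : nat) : \bar R :=
  if x is y.+1 then h y else -oo%E.

Definition odb_step (e : nat -> bool) (h : nat -> \bar R) (x : nat) : \bar R :=
  if (h x < odb_left h x)%E then odb_left h x
  else if e x then (h x + 1)%E else h x.

(* [e t x] is the coin used at site [x] in the step from time [t] to [t.+1]. *)
Fixpoint odb_height (e : nat -> nat -> bool) (t : nat) : nat -> \bar R :=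
  if t is s.+1 then odb_step (e s) (odb_height e s) else odb_init.

End OrientedDigitalBoiling.

Section BrownianMaximum.
Context {R : realType} {T : Type} {x : nat}.
Variable B : 'I_x.+1 -> R -> T -> R.

Definition time_sequences : set (nat -> R) :=
  [set t | [/\ 0 <= t 0%N, forall i, (i < x)%N -> t i <= t i.+1 & t x = 1]].

(* [lift ord0 i] is the index [i.+1] of ['I_x.+1]. *)
Definition path_value (w : T) (t : nat -> R) : R :=
  B ord0 (t 0%N) w +
  \sum_(i < x) (B (lift ord0 i) (t i.+1) w - B (lift ord0 i) (t i) w).

(* For continuous paths this supremum is a maximum: see
   [brownian_max_attained]. *)
Definition brownian_max (w : T) : R := sup (path_value w @` time_sequences).

End BrownianMaximum.

Lemma continuous_path_sum {R : realType} (S : topologicalType) (x : nat)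
    (g : 'I_x.+1 -> nat -> S -> R) :
  (forall k i, continuous (g k i)) ->
  continuous (fun t => g ord0 0%N t +
    \sum_(i < x) (g (lift ord0 i) i.+1 t - g (lift ord0 i) i t)).
Proof.
move=> cg t.
pose F (i : 'I_x) t := g (lift ord0 i) i.+1 t - g (lift ord0 i) i t.
have cs (r : seq 'I_x) : continuous (fun t => \sum_(i <- r) F i t).
  elim: r => [|i r IHr] u.
    under [fun t => _]eq_fun do rewrite big_nil.
    exact: cst_continuous.
  under [fun t => _]eq_fun do rewrite big_cons.
  apply: (@continuousD R R^o S _ _ u) (IHr u).
  exact: (@continuousB R R^o S _ _ u (@cg _ _ u) (@cg _ _ u)).
exact: (@continuousD R R^o S _ _ t (@cg _ _ t) (cs _ t)).
Qed.

Lemma continuous_abs_comp {R : realType} (f : R -> R) :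
  {within `[0, +oo[, continuous f} -> continuous (fun s : R => f `|s|).
Proof.
move=> /subspace_continuousP cf s.
have f0 : f @ within `[0, +oo[%classic (nbhs `|s|) --> f `|s|.
  by apply: cf; rewrite /= in_itv/= andbT.
apply: (@cvg_comp _ _ _ (fun s : R => `|s|) f _ _ _ _ f0) => A hA.
have := @norm_continuous R R^o s _ hA.
rewrite nbhs_simpl/=; apply: filterS => y /=; apply.
by rewrite in_itv/= andbT.
Qed.

Lemma brownian_max_attained {R : realType} {d : measure_display}
    {T : measurableType d} (P : probability T R) (x : nat)
    (B : 'I_x.+1 -> R -> T -> R) (w : T) :
  brownian_motion_dim P B ->
  let A := path_value B w @` time_sequences (R := R) (x := x) in
  A (brownian_max B w) /\ ubound A (brownian_max B w).
Proof.
move=> [bB _] A.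
have cB k : continuous (fun s : R => B k `|s| w).
  have [_ _ cW _ _] := bB k.
  exact: (@continuous_abs_comp _ (fun s => B k s w) (cW w)).
pose K : set (prod_topology (fun _ : nat => R)) :=
  [set t | (forall i, `[0, 1]%classic (t i)) /\
           ((forall i, (i < x)%N -> t i <= t i.+1) /\ t x = 1)].
pose f (t : prod_topology (fun _ : nat => R)) : R :=
  B ord0 `|t 0%N| w + \sum_(i < x)
    (B (lift ord0 i) `|t i.+1| w - B (lift ord0 i) `|t i| w).
have pc i : continuous (fun t : prod_topology (fun _ : nat => R) => t i).
  exact: (@proj_continuous nat (fun _ => R) i).
have cp k i : continuous (fun t : prod_topology (fun _ : nat => R) =>
    B k `|t i| w).
  move=> t; exact: (@cvg_comp _ _ _ (fun t : prod_topology (fun _ => R) => t i)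
    (fun s => B k `|s| w) _ _ _ (pc i t) (cB k (t i))).
have cf : continuous f.
  exact: (@continuous_path_sum R _ x
    (fun k i (t : prod_topology (fun _ : nat => R)) => B k `|t i| w)).
have cK : compact K.
  have -> : K = [set t : prod_topology (fun _ : nat => R) |
                 forall i, `[0, 1]%classic (t i)] `&`
     ((\bigcap_(i in [set i | (i < x)%N])
        ((fun t : prod_topology (fun _ : nat => R) => t i.+1 - t i)
          @^-1` [set y | 0 <= y])) `&`
      (fun t : prod_topology (fun _ : nat => R) => t x) @^-1` [set y | y = 1]).
    apply/seteqP; split=> t /=.
      by move=> [t01 [tm t1]]; split=> //; split=> // i /= ix; rewrite subr_ge0 tm.
    by move=> [t01 [tm t1]]; split=> //; split=> // i /= ix;
       rewrite -subr_ge0; apply: tm.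
  apply: compact_closedI.
    by apply: (@tychonoff nat (fun _ => R) (fun _ => `[0, 1]%classic)) => i;
       exact: segment_compact.
  apply: closedI.
    apply: closed_bigI => i _; apply: preimage_closed; last exact: closed_ge.
    move=> t _.
    exact: (@continuousB R R^o (prod_topology (fun _ : nat => R)) _ _ t
      (pc _ t) (pc _ t)).
  by apply: preimage_closed; [move=> t _; exact: pc|exact: closed_eq].
have K0 : K !=set0.
  exists (fun _ => 1); split=> [i|]; first by rewrite /= in_itv/= ler01 lexx.
  by split.
have [c cK' cmax] : exists2 c, c \in K & forall t, t \in K -> f t <= f c.
  by apply: compact_EVT_max => //; exact: continuous_subspaceT.
have pf (t : nat -> R) : (forall i, (i <= x)%N -> 0 <= t i) ->
    f t = path_value B w t.
  move=> t0; rewrite /f /path_value ger0_norm ?t0//; congr (_ + _).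
  apply: eq_bigr => i _.
  by rewrite !ger0_norm// t0// ?ltn_ord// ltnW// ltn_ord.
have tmon (t : nat -> R) : (forall i, (i < x)%N -> t i <= t i.+1) ->
    forall i j, (i <= j <= x)%N -> t i <= t j.
  move=> tm i; elim=> [|j ij] /andP[].
    by rewrite leqn0 => /eqP ->.
  rewrite leq_eqVlt => /predU1P[-> //|]; rewrite ltnS => lij jx.
  by apply: (le_trans (ij _)); [rewrite lij ltnW|exact: tm].
have cKc : K c by exact: set_mem.
have Ac : A (f c).
  case: cKc => c01 [cm c1].
  have c0 i : 0 <= c i by have := c01 i; rewrite /= in_itv/= => /andP[].
  by exists c; [split=> //; exact: c0|rewrite -pf].
have Ub : ubound A (f c).
  move=> _ [t [t0 tm t1] <-].
  pose t' i := t (minn i x).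
  have t'01 i : 0 <= t' i <= 1.
    have ixx : (minn i x <= x)%N by rewrite geq_minr.
    have t0i : t 0%N <= t (minn i x) by apply: (tmon t tm); rewrite leq0n.
    have tix : t (minn i x) <= t x by apply: (tmon t tm); rewrite ixx leqnn.
    by rewrite /t' (le_trans t0 t0i) -t1 tix.
  have t'E i : (i <= x)%N -> t' i = t i by move=> ix; rewrite /t' (minn_idPl ix).
  have -> : path_value B w t = path_value B w t'.
    rewrite /path_value t'E//; congr (_ + _); apply: eq_bigr => i _.
    by rewrite !t'E// ?ltn_ord// ltnW// ltn_ord.
  rewrite -pf; last by move=> i _; have /andP[] := t'01 i.
  apply: cmax; apply/mem_set; split=> [i|]; first by rewrite /= in_itv/= t'01.
  split; last by rewrite t'E.
  by move=> i ix; rewrite !t'E// ?tm// ltnW.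
have -> : brownian_max B w = f c.
  apply/le_anti/andP; split.
    by apply: ge_sup => //; exists (f c).
  by apply: ub_le_sup => //; exists (f c).
by split.
Qed.

(* Main.v *)
Require Import Defs.
From HB Require Import structures.
From mathcomp Require Import all_boot all_order all_algebra.
From mathcomp Require Import all_classical all_reals all_analysis.
From mathcomp Require Import measurable_realfun.
From mathcomp Require Import ring lra zify.
Import Order.TTheory GRing.Theory Num.Theory.
Import numFieldNormedType.Exports.
Local Open Scope classical_set_scope.
Local Open Scope ring_scope.
Set Implicit Arguments.
Unset Strict Implicit.
Unset Printing Implicit Defensive.

(** Up to an error depending on [x] only, [h_t(x)] is the maximum over
    climbing sequences [tau_0 <= ... <= tau_x = t] of a sum of increments of
    [x + 1] independent Bernoulli walks, which is the discrete version of the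
    Brownian functional. Both maxima are compared to their restrictions to a
    grid of [m] time blocks. For the walks the price is a fourth-moment
    maximal inequality in every block, whose total is O(1/m); for the Brownian
    motions the dyadic restrictions increase to the supremum by continuity of
    paths. For fixed [m], the grid functional is a Lipschitz function of
    finitely many independent increments, so it suffices to know the limits of
    probabilities of boxes, i.e. the de Moivre-Laplace theorem. The latter is
    proved by a Lindeberg exchange along the explicit heat flow
    [Phi (z / sqrt v)]. *)

(** * The Gaussian distribution function *)

(** Fourth moments are dictated by the number of blocks: about [m] blocks of length about [t / m]
    each oscillate on scale [sqrt t] with probability O(1/m^2) by fourth moments, but only O(1/m) by
    variances, and the latter bound does not vanish after summation.

    Since only distribution functions are compared, maxima over climbing sequences never occur as
    values. [grid_le] says that the maximum is at most [r], and the Lipschitz property says that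
    moving the coordinates by [eta] raises the threshold by a multiple of [eta]. Every comparison is
    thus an inclusion of events with a shifted threshold, and continuity of the limit law at [r]
    removes the shift at the end.

    The oscillation bound depends on the shift but not on [m]. So the shift can be fixed first, then
    the grid, then the boxes, and [t] last; no convergence has to be uniform in [m].

    On the discrete side all expectations are finite recursions over coins; independence enters only
    through probabilities of cylinders and boxes. *)

Section RealDerivatives.
Context {R : realType}.
Implicit Types f g : R -> R.

Lemma rderiv_comp f g (x a b : R) : is_derive (g x) 1 f a ->
  is_derive x 1 g b -> is_derive x 1 (fun y => f (g y)) (a * b).
Proof. by move=> hf hg; exact: (@is_derive1_comp _ _ _ _ _ _ hf hg). Qed.

Lemma rderiv_mul f g (x a b : R) : is_derive x 1 f a -> is_derive x 1 g b ->
  is_derive x 1 (fun y => f y * g y) (f x * b + g x * a).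
Proof. by move=> hf hg; exact: (@is_deriveM _ _ _ _ _ _ _ _ hf hg). Qed.

Lemma rderiv_add f g (x a b : R) : is_derive x 1 f a -> is_derive x 1 g b ->
  is_derive x 1 (fun y => f y + g y) (a + b).
Proof. by move=> hf hg; exact: (@is_deriveD _ _ _ _ _ _ _ _ _ hf hg). Qed.

Lemma rderiv_cst (k x : R) : is_derive x 1 (fun=> k) (0 : R).
Proof. exact: is_derive_cst. Qed.

Lemma rderiv_scale f (k x a : R) : is_derive x 1 f a ->
  is_derive x 1 (fun y => k * f y) (k * a).
Proof.
move=> hf; apply: (is_derive_eq (rderiv_mul (rderiv_cst k x) hf)); ring.
Qed.

Lemma rderiv_sub f g (x a b : R) : is_derive x 1 f a -> is_derive x 1 g b ->
  is_derive x 1 (fun y => f y - g y) (a - b).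
Proof.
by move=> hf hg; exact: (@is_deriveB _ _ _ _ _ _ _ _ _ hf hg).
Qed.

Lemma rderiv_opp f (x a : R) : is_derive x 1 f a ->
  is_derive x 1 (fun y => - f y) (- a).
Proof. by move=> hf; exact: (@is_deriveN _ _ _ _ _ _ _ hf). Qed.

Lemma rderiv_id (x : R) : is_derive x 1 (fun y : R => y) (1 : R).
Proof. exact: is_derive_id. Qed.

Lemma rderiv_inv f (x a : R) : f x != 0 -> is_derive x 1 f a ->
  is_derive x 1 (fun y => (f y)^-1) (- a / f x ^+ 2).
Proof.
move=> f0 hf; apply: (is_derive_eq (is_deriveV f0 hf)).
by rewrite /GRing.scale/= mulrC mulrN mulNr.
Qed.

Lemma mvt_bound_ge0 f (df : R -> R) (M b : R) : 0 <= b ->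
  (forall x : R, 0 <= x <= b -> is_derive x 1 f (df x)) ->
  f 0 = 0 -> (forall c, 0 <= c <= b -> `|df c| <= M) -> `|f b| <= M * b.
Proof.
move=> b0 hf f0 hM.
have cf : {within `[0, b], continuous f}.
  apply: continuous_in_subspaceT => x; rewrite inE/= in_itv/= => /hf d.
  by apply: differentiable_continuous; apply/derivable1_diffP.
have d x : x \in `]0, b[%R -> is_derive x 1 f (df x).
  by rewrite in_itv/= => /andP[x0 xb]; apply: hf; rewrite !ltW.
have [c] := MVT_segment b0 d cf.
rewrite in_itv/= f0 !subr0 => cb ->.
by rewrite normrM (ger0_norm b0) ler_wpM2r// hM.
Qed.

Lemma mvt_bound f (df : R -> R) (M b : R) :
  (forall x : R, is_derive x 1 f (df x)) ->
  f 0 = 0 -> (forall c, `|c| <= `|b| -> `|df c| <= M) -> `|f b| <= M * `|b|.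
Proof.
move=> hf f0 hM; have [b0|b0] := leP 0 b.
  rewrite (ger0_norm b0).
  apply: (@mvt_bound_ge0 f df) => // c /andP[c0 cb].
  by apply: hM; rewrite !ger0_norm.
rewrite (ltr0_norm b0) -{1}(opprK b).
apply: (@mvt_bound_ge0 (fun x => f (- x)) (fun x => - df (- x))).
- by rewrite oppr_ge0 ltW.
- move=> x _; apply: (is_derive_eq (rderiv_comp (hf _)
    (rderiv_opp (rderiv_id x)))).
  by ring.
- by rewrite /= oppr0.
move=> c /andP[c0 cb]; rewrite normrN; apply: hM.
by rewrite normrN (ltr0_norm b0) ger0_norm.
Qed.

(** Two nested mean value bounds, for the remainder and for its derivative. This crude iteration
    gives [K] where an integral remainder would give [K / 6]. *)
Lemma taylor2 g (g1 g2 : R -> R) (K y b : R) :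
  (forall x : R, is_derive x 1 g (g1 x)) -> (forall x : R, is_derive x 1 g1 (g2 x)) ->
  (forall u v, `|g2 u - g2 v| <= K * `|u - v|) ->
  `|g (y + b) - g y - b * g1 y - b ^+ 2 / 2 * g2 y| <= K * `|b| ^+ 3.
Proof.
move=> h1 h2 hK.
have K0 : 0 <= K.
  by have := hK 1 0; rewrite subr0 normr1 mulr1; apply: le_trans.
have dsh f (df : R -> R) : (forall x : R, is_derive x 1 f (df x)) ->
    forall x : R, is_derive x 1 (fun b => f (y + b)) (df (y + x)).
  move=> hf x.
  apply: (is_derive_eq (rderiv_comp (hf _) (rderiv_add (rderiv_cst y x) (rderiv_id x)))).
  ring.
have -> : K * `|b| ^+ 3 = K * `|b| * `|b| * `|b| by ring.
apply: (@mvt_bound (fun b => g (y + b) - g y - b * g1 y - b ^+ 2 / 2 * g2 y)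
  (fun b => g1 (y + b) - g1 y - b * g2 y)).
- move=> x; apply: (is_derive_eq (rderiv_sub (rderiv_sub (rderiv_sub (dsh _ _ h1 x)
    (rderiv_cst (g y) x)) (rderiv_mul (rderiv_id x) (rderiv_cst (g1 y) x)))
    (rderiv_mul (rderiv_mul (rderiv_mul (rderiv_id x) (rderiv_id x)) (rderiv_cst 2^-1 x))
       (rderiv_cst (g2 y) x)))).
  by field.
- by rewrite /= addr0 subrr expr0n/= !mul0r !subr0.
move=> c cb; apply: (@le_trans _ _ (K * `|b| * `|c|)); last first.
  by rewrite ler_wpM2l// mulr_ge0.
apply: (@mvt_bound (fun b => g1 (y + b) - g1 y - b * g2 y)
  (fun b => g2 (y + b) - g2 y)).
- move=> x; apply: (is_derive_eq (rderiv_sub (rderiv_sub (dsh _ _ h2 x)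
    (rderiv_cst (g1 y) x)) (rderiv_mul (rderiv_id x) (rderiv_cst (g2 y) x)))).
  ring.
- by rewrite /= addr0 subrr !mul0r !subr0.
move=> e ec; apply: (le_trans (hK _ _)).
by rewrite (_ : y + e - y = e) ?ler_wpM2l//; [exact: le_trans cb|ring].
Qed.

End RealDerivatives.

Section Gaussian.
Context {R : realType}.
Local Notation mu := (@lebesgue_measure R).

Definition normal_cdf (s r : R) : R := fine (normal_prob 0 s `]-oo, r]).

Lemma normal_cdfE (s r : R) : normal_prob 0 s `]-oo, r] = (normal_cdf s r)%:E.
Proof. by rewrite /normal_cdf fineK// fin_num_measure. Qed.

Lemma normal_cdf_ge0 (s r : R) : 0 <= normal_cdf s r.
Proof. by rewrite -lee_fin -normal_cdfE. Qed.

Lemma normal_cdf_le1 (s r : R) : normal_cdf s r <= 1.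
Proof. by rewrite -lee_fin -normal_cdfE probability_le1. Qed.

Lemma normal_cdf_homo (s : R) : {homo normal_cdf s : a b / a <= b}.
Proof.
move=> a b ab; rewrite -lee_fin -!normal_cdfE.
by apply: le_measure; rewrite ?inE//; exact: subitvPr.
Qed.

Let id_rv : measurableTypeR R -> R := id.

#[local] HB.instance Definition _ :=
  @isMeasurableFun.Build _ _ _ _ id_rv (@measurable_id _ _ setT).

(** Under [normal_prob 0 s] the identity is a random variable, so the limits at infinity are those
    of a [cdf]. *)
Let normal_cdf_rv (s : R) :
  exists f : {RV (normal_prob 0 s) >-> R}, normal_cdf s = fine \o cdf f.
Proof. by exists (id_rv : {RV (normal_prob 0 s) >-> R}). Qed.

Lemma normal_cdf_cvgNy (s : R) : normal_cdf s r @[r --> -oo] --> (0 : R).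
Proof. by have [f ->] := normal_cdf_rv s; exact/fine_cvg/cvg_cdfNy0. Qed.

Lemma normal_cdf_cvgy (s : R) : normal_cdf s r @[r --> +oo] --> (1 : R).
Proof. by have [f ->] := normal_cdf_rv s; exact/fine_cvg/cvg_cdfy1. Qed.

Lemma is_derive_normal_cdf (s r : R) : s != 0 ->
  is_derive r 1 (normal_cdf s) (normal_pdf 0 s r).
Proof.
move=> s0.
have [||||] := @continuous_FTC1 R (normal_pdf 0 s) -oo%O r (r + 1).
- by rewrite ltrDl.
- exact: (integrableS measurableT _ (@subsetT _ _) (integrable_normal_pdf 0 s)).
- by rewrite ltNyr.
- exact: (continuous_normal_pdf s0).
move=> d1 d2; apply: DeriveDef => //.
by rewrite -d2 derive1E.
Qed.

Definition Phi : R -> R := normal_cdf 1.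
Definition phi (u : R) : R := normal_pdf 0 1 u.

Global Instance is_derive_Phi (u : R) : is_derive u 1 Phi (phi u).
Proof. exact: is_derive_normal_cdf. Qed.

Lemma phiE (u : R) : phi u = normal_peak 1 * expR (- (u ^+ 2 / 2)).
Proof.
by rewrite /phi normal_pdfE// /normal_fun subr0 expr1n mulNr.
Qed.

Global Instance is_derive_phi (u : R) : is_derive u 1 phi (- (u * phi u)).
Proof.
have -> : phi = fun u => normal_peak 1 * expR (- 2^-1 * (u * u)).
  by apply/funext => v; rewrite phiE; congr (_ * expR _); field.
apply: (is_derive_eq (rderiv_scale (normal_peak 1) (rderiv_comp (is_derive_expR _)
  (rderiv_scale (- 2^-1) (rderiv_mul (rderiv_id u) (rderiv_id u)))))).
by field.
Qed.

Lemma phi_ge0 u : 0 <= phi u. Proof. exact: normal_pdf_ge0. Qed.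

(** The derivatives used below are [phi] times polynomials of degree at most 3, so one weight of
    degree 4 serves them all. The constant comes from 1 + u^4 <= 16 (1 + u^2/4)^2 and 1 + s <= exp s
    at s = u^2/4. *)
Lemma phi_decay (u : R) : (1 + u ^+ 4) * phi u <= 16.
Proof.
have pk : 0 < normal_peak (1 : R) <= 1.
  rewrite normal_peak_gt0//= /normal_peak expr1n mul1r invf_le1.
    rewrite -[leLHS]sqrtr1 ler_wsqrtr//; have := pi_ge2 R; lra.
  rewrite sqrtr_gt0; have := pi_ge2 R; lra.
have e : 1 + u ^+ 4 <= 16 * expR (u ^+ 2 / 2).
  have e1 : 1 + u ^+ 2 / 4 <= expR (u ^+ 2 / 4) by exact: expR_ge1Dx.
  have -> : u ^+ 2 / 2 = u ^+ 2 / 4 + u ^+ 2 / 4 by field.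
  rewrite expRD -expr2.
  have u2 := sqr_ge0 u.
  apply: (@le_trans _ _ (16 * (1 + u ^+ 2 / 4) ^+ 2)); first by nra.
  by rewrite ler_pM2l// lerXn2r// nnegrE; [lra|exact: expR_ge0].
rewrite phiE expRN mulrCA -ler_pdivlMl; last by case/andP: pk.
apply: (@le_trans _ _ 16); first by rewrite ler_pdivrMr ?expR_gt0.
by rewrite ler_peMl// invf_ge1; case/andP: pk.
Qed.

(* Both sides have the same derivative in [r] and vanish at [-oo]. *)
Lemma normal_cdf_scale (s r : R) : 0 < s -> normal_cdf s r = Phi (r / s).
Proof.
move=> s0.
pose f r := normal_cdf s r - Phi (r / s).
have df (x : R) : is_derive x 1 f 0.
  have h3 := @is_derive_normal_cdf s x (lt0r_neq0 s0).
  apply: (is_derive_eq (rderiv_sub h3 (rderiv_comp (is_derive_Phi _)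
    (rderiv_mul (rderiv_id x) (rderiv_cst s^-1 x))))).
  rewrite mulr0 add0r mulr1.
  rewrite phiE normal_pdfE ?gt_eqF//= /normal_peak /normal_fun subr0 expr1n mul1r.
  rewrite -mulrnAr sqrtrM ?sqr_ge0// sqrtr_sqr gtr0_norm// invfM.
  have -> : - x ^+ 2 / (s ^+ 2 *+ 2) = - ((x / s) ^+ 2 / 2).
    by rewrite -mulr_natr; field; rewrite gt_eqF.
  by ring.
have f0 x : f x = f 0 by exact: (is_derive_0_is_cst x 0).
have fl : f r @[r --> -oo] --> (0 : R).
  rewrite -(subr0 0); apply: cvgB; first exact: normal_cdf_cvgNy.
  apply: (@cvg_comp _ _ _ (fun r => r / s) Phi _ -oo); last exact: normal_cdf_cvgNy.
  apply/cvgrNyPle => A; exists (A * s); split; first exact: num_real.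
  by move=> y yA; rewrite ler_pdivrMr// ltW.
have fl0 : f r @[r --> -oo] --> f 0.
  by rewrite (_ : f = cst (f 0)); [exact: cvg_cst|apply/funext].
have e : 0 = f 0 by apply: (cvg_unique _ fl fl0).
by apply/eqP; rewrite -subr_eq0; apply/eqP; rewrite -/(f r) f0.
Qed.

End Gaussian.

(** * Taylor expansions of the heat flow in space and time *)

Section HeatFlow.
Context {R : realType}.

(** The probability that a centred normal variable of variance [v] is at most [z]. With w = 1/sqrt
    v, its derivative in [v] and half its second derivative in [z] both equal - w^2 * uphi (z * w) /
    2: this is the heat equation. *)
Definition heat (v z : R) : R := Phi (z * (Num.sqrt v)^-1).

Definition uphi (u : R) : R := u * phi u.

Let dk (u : R) : is_derive u 1 uphi ((1 - u ^+ 2) * phi u).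
Proof.
by rewrite /uphi; apply: (is_derive_eq (rderiv_mul (rderiv_id u) (is_derive_phi u))); ring.
Qed.

Let phi_bound (c u : R) (C : R) : `|c| <= C * (1 + u ^+ 4) -> `|c * phi u| <= C * 16.
Proof.
move=> cC; rewrite normrM (ger0_norm (phi_ge0 u)).
have C0 : 0 <= C.
  have : 0 <= C * (1 + u ^+ 4) by apply: le_trans cC.
  by rewrite pmulr_lge0// ltr_pwDl// exprn_even_ge0.
apply: (le_trans (ler_wpM2r (phi_ge0 u) cC)).
by rewrite -mulrA ler_wpM2l// phi_decay.
Qed.

Let dw (v : R) : 0 < v ->
  is_derive v 1 (fun v => (Num.sqrt v)^-1) (- 2^-1 * (Num.sqrt v)^-1 ^+ 3).
Proof.
move=> v0; have s0 : 0 < Num.sqrt v by rewrite sqrtr_gt0.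
apply: (is_derive_eq (rderiv_inv (lt0r_neq0 s0) (is_derive1_sqrt v0))).
by field; rewrite gt_eqF.
Qed.

Let w_le (u v : R) : 0 < u <= v -> 0 <= (Num.sqrt v)^-1 <= (Num.sqrt u)^-1.
Proof.
move=> /andP[u0 uv]; rewrite invr_ge0 sqrtr_ge0/= lef_pV2 ?posrE ?sqrtr_gt0 ?ler_wsqrtr//.
exact: lt_le_trans uv.
Qed.

Let lip_k (u v : R) : `|uphi u - uphi v| <= 16 * `|u - v|.
Proof.
have := @mvt_bound R (fun x => uphi (v + x) - uphi v)
  (fun x => (1 - (v + x) ^+ 2) * phi (v + x)) 16 (u - v).
rewrite subrKC; apply.
- move=> x; apply: (is_derive_eq (rderiv_sub (rderiv_comp (dk _)
    (rderiv_add (rderiv_cst v x) (rderiv_id x))) (rderiv_cst (uphi v) x))).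
  by ring.
- by rewrite addr0 subrr.
move=> c _; rewrite -[leRHS]mul1r; apply: phi_bound.
have := sqr_ge0 (v + c); rewrite (exprM _ 2 2) ler_norml.
move: (_ ^+ 2) => s s0; have := sqr_ge0 (s - 1 / 2).
by move=> ?; apply/andP; split; nra.
Qed.

Lemma heat_taylor_space (v z b w : R) : 0 < v -> w = (Num.sqrt v)^-1 ->
  `|heat v (z + b) - heat v z - b * (w * phi (z * w))
    + b ^+ 2 / 2 * (w ^+ 2 * (z * w * phi (z * w)))| <= 16 * w ^+ 3 * `|b| ^+ 3.
Proof.
move=> v0 wE.
have w0 : 0 <= w by rewrite wE invr_ge0 sqrtr_ge0.
have := @taylor2 R (heat v) (fun z => w * phi (z * w))
  (fun z => - (w ^+ 2 * uphi (z * w))) (16 * w ^+ 3) z b.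
rewrite mulrN opprK; apply.
- move=> x; rewrite (_ : heat v = fun z => Phi (z * w)); last by rewrite wE.
  apply: (is_derive_eq (rderiv_comp (is_derive_Phi _)
    (rderiv_mul (rderiv_id x) (rderiv_cst w x)))).
  by ring.
- move=> x; apply: (is_derive_eq (rderiv_scale w (rderiv_comp (is_derive_phi _)
    (rderiv_mul (rderiv_id x) (rderiv_cst w x))))).
  by rewrite /uphi; ring.
move=> a c; rewrite -opprD normrN -mulrBr normrM ger0_norm ?exprn_ge0//.
have := lip_k (a * w) (c * w); rewrite -mulrBl normrM (ger0_norm w0) => h.
apply: (le_trans (ler_wpM2l (exprn_ge0 2 w0) h)).
by rewrite le_eqVlt; apply/orP; left; apply/eqP; ring.
Qed.

(** By the heat equation the linear term has the same factor as the quadratic term of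
    [heat_taylor_space], which lets the two cancel in [flip_heat]. Each derivative in time costs a
    factor w^2, hence w^4 in the remainder. *)
Lemma heat_taylor_time (v z h w : R) : 0 < v -> 0 <= h ->
  w = (Num.sqrt v)^-1 ->
  `|heat (v + h) z - heat v z + h / 2 * (w ^+ 2 * (z * w * phi (z * w)))|
    <= 16 * w ^+ 4 * h ^+ 2.
Proof.
move=> v0 h0 wE.
have w0 : 0 <= w by rewrite wE invr_ge0 sqrtr_ge0.
pose W x : R := (Num.sqrt (v + x))^-1.
have dW (x : R) : 0 <= x -> is_derive x 1 W (- 2^-1 * W x ^+ 3).
  move=> x0; apply: (is_derive_eq (rderiv_comp (@dw (v + x) _)
    (rderiv_add (rderiv_cst v x) (rderiv_id x)))).
    by rewrite ltr_wpDr.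
  by rewrite /W; ring.
have Ww (x : R) : 0 <= x -> 0 <= W x <= w.
  by move=> x0; rewrite wE; apply: w_le; rewrite v0 lerDl.
have dG (x : R) : 0 <= x -> is_derive x 1 (fun x => W x ^+ 2 * uphi (z * W x))
    (- (W x ^+ 4 * (uphi (z * W x) +
      2^-1 * (z * W x * (1 - (z * W x) ^+ 2) * phi (z * W x))))).
  move=> x0; have d := dW _ x0.
  apply: (is_derive_eq (rderiv_mul (rderiv_mul d d) (rderiv_comp (dk _)
    (rderiv_mul (rderiv_cst z x) d)))).
  by rewrite /uphi; field.
have -> : 16 * w ^+ 4 * h ^+ 2 = 16 * w ^+ 4 * h * h by ring.
have hF := @mvt_bound_ge0 R
  (fun x => heat (v + x) z - heat v z + x * (2^-1 * (w ^+ 2 * (z * w * phi (z * w)))))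
  (fun x => - 2^-1 * (W x ^+ 2 * uphi (z * W x)) + 2^-1 * (w ^+ 2 * uphi (z * w)))
  (16 * w ^+ 4 * h) h h0.
rewrite -[h / 2 * _]mulrA; apply: hF.
- move=> x /andP[x0 _]; have d := dW _ x0.
  apply: (is_derive_eq (rderiv_add (rderiv_sub (rderiv_comp (is_derive_Phi _)
    (rderiv_mul (rderiv_cst z x) d)) (rderiv_cst (heat v z) x))
    (rderiv_mul (rderiv_id x) (rderiv_cst _ x)))).
  by rewrite /uphi -/(W x); field.
- by rewrite addr0 subrr mul0r addr0.
move=> c /andP[c0 ch].
rewrite [X in `|X|](_ : _ = 2^-1 * (w ^+ 2 * uphi (z * w) - W c ^+ 2 * uphi (z * W c)));
  last by ring.
rewrite normrM.
apply: (@le_trans _ _ (1 * (16 * w ^+ 4 * c))); last first.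
  by rewrite mul1r ler_wpM2l// mulr_ge0// exprn_ge0.
apply: ler_pM => //; first by rewrite ger0_norm// invf_le1//; lra.
rewrite -normrN opprB.
have := @mvt_bound_ge0 R (fun x => W x ^+ 2 * uphi (z * W x) - w ^+ 2 * uphi (z * w))
  (fun x => (- (W x ^+ 4 * (uphi (z * W x) +
      2^-1 * (z * W x * (1 - (z * W x) ^+ 2) * phi (z * W x)))))) (16 * w ^+ 4) c c0.
apply.
- move=> x /andP[x0 _]; apply: (is_derive_eq (rderiv_sub (dG _ x0) (rderiv_cst _ x))).
  by rewrite subr0.
- by rewrite /W addr0 -wE subrr.
move=> x /andP[x0 _]; have /andP[W0 W1] := Ww _ x0.
rewrite normrN normrM (ger0_norm (exprn_ge0 4 W0)) mulrC.
apply: ler_pM => //; first exact: exprn_ge0.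
  set u := z * W x; rewrite /uphi [2^-1 * _]mulrA -mulrDl -[leRHS]mul1r.
  apply: phi_bound.
  (* The polynomial inequality is |3u/2 - u^3/2| <= 1 + u^4. *)
  rewrite ler_norml; apply/andP; split.
    have := sqr_ge0 (u ^+ 2 - u / 4 - 1 / 2); have := sqr_ge0 (u - 2 / 3); nra.
  have := sqr_ge0 (u ^+ 2 + u / 4 - 1 / 2); have := sqr_ge0 (u + 2 / 3); nra.
by apply: lerXn2r.
Qed.

Lemma Phi_le1 (u : R) : Phi u <= 1. Proof. exact: normal_cdf_le1. Qed.

Lemma Phi_ge0 (u : R) : 0 <= Phi u. Proof. exact: normal_cdf_ge0. Qed.

Lemma Phi_homo : {homo (@Phi R) : u v / u <= v}.
Proof. exact: normal_cdf_homo. Qed.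

Lemma continuous_Phi : continuous (@Phi R).
Proof.
move=> u; apply: differentiable_continuous.
by apply/derivable1_diffP; have [] := is_derive_Phi u.
Qed.

(* The indicator of a half-line is compared to the heat kernel at the small
   time [c ^ 2], shifted by [c * L]. *)
Lemma heat_indicator_ub (c L r y : R) : 0 < c ->
  (y <= r)%R%:R <= heat (c ^+ 2) (r + c * L - y) + (1 - Phi L).
Proof.
move=> c0; rewrite /heat sqrtr_sqr gtr0_norm//.
case: (leP y r) => yr /=; rewrite ?mulr1n ?mulr0n; last first.
  by have := Phi_ge0 ((r + c * L - y) / c); have := Phi_le1 L; lra.
have : Phi L <= Phi ((r + c * L - y) / c).
  by apply: Phi_homo; rewrite ler_pdivlMr//; nra.
lra.
Qed.

Lemma heat_indicator_lb (c L r y : R) : 0 < c ->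
  heat (c ^+ 2) (r - c * L - y) + - Phi (- L) <= (y <= r)%R%:R.
Proof.
move=> c0; rewrite /heat sqrtr_sqr gtr0_norm//.
case: (leP y r) => yr /=; rewrite ?mulr1n ?mulr0n.
  by have := Phi_ge0 (- L); have := Phi_le1 ((r - c * L - y) / c); lra.
have : Phi ((r - c * L - y) / c) <= Phi (- L).
  by apply: Phi_homo; rewrite ler_pdivrMr//; nra.
lra.
Qed.

Lemma heat_continuous_time (z v : R) : 0 < v -> {for v, continuous (heat ^~ z)}.
Proof.
move=> v0; apply: continuous_comp; last exact: continuous_Phi.
apply: cvgMr; apply: cvgV; first by rewrite sqrtr_eq0 -ltNge.
exact: sqrt_continuous.
Qed.

(** Removes the smoothing: [c] is its standard deviation and [c * L] the shift that compensates for
    it in [heat_indicator_ub] and [heat_indicator_lb]. *)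
Lemma heat_continuous_shift (v r L : R) : 0 < v ->
  (fun c : R => heat (c ^+ 2 + v) (r + c * L)) @ 0 --> heat v r.
Proof.
move=> v0; rewrite /heat.
apply: (@cvg_comp _ _ _ _ (@Phi R)); last exact: continuous_Phi.
have -> : r / Num.sqrt v = (r + 0 * L) / Num.sqrt (0 ^+ 2 + v).
  by rewrite mul0r addr0 expr0n/= add0r.
apply: cvgM.
  by apply: cvgD; [exact: cvg_cst|apply: cvgMl; exact: cvg_id].
apply: cvgV; first by rewrite expr0n/= add0r sqrtr_eq0 -ltNge.
apply: continuous_cvg; first exact: sqrt_continuous.
by apply: cvgD; [apply: exprn_continuous|exact: cvg_cst].
Qed.

End HeatFlow.

(** * The de Moivre-Laplace theorem *)

Section Flip.
Context {R : realType}.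
Variable p : R.

(** The expectation of [f (y + a * (b - p))] over one coin [b] of parameter [p]; its iterates are
    expectations over walks, by [bexp_flip]. *)
Definition flip (a : R) (f : R -> R) (y : R) : R :=
  p * f (y + (1 - p) * a) + (1 - p) * f (y - p * a).

Hypothesis p01 : 0 < p < 1.

Lemma flip_le (a : R) (f g : R -> R) : (forall y, f y <= g y) ->
  forall y, flip a f y <= flip a g y.
Proof.
move=> fg y; have /andP[p0 p1] := p01.
by apply: lerD; apply: ler_wpM2l => //; lra.
Qed.

Lemma iter_flip_le (a : R) (f g : R -> R) n : (forall y, f y <= g y) ->
  forall y, iter n (flip a) f y <= iter n (flip a) g y.
Proof. by move=> fg; elim: n => //= n IHn; exact: flip_le. Qed.

Lemma iter_flipDc (a : R) (f : R -> R) (c : R) n y :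
  iter n (flip a) (fun y => f y + c) y = iter n (flip a) f y + c.
Proof. by elim: n y => //= n IHn y; rewrite /flip !IHn; ring. Qed.

Let convex_norm3 (x1 x2 x3 e1 e2 : R) : `|x1| <= e1 -> `|x2| <= e1 ->
  `|x3| <= e2 -> `|p * x1 + (1 - p) * x2 - x3| <= e1 + e2.
Proof.
move=> h1 h2 h3; have /andP[p0 p1] := p01.
have q0 : 0 <= 1 - p by lra.
apply: (le_trans (ler_normB _ _)); apply: lerD => //.
apply: (le_trans (ler_normD _ _)); rewrite !normrM (gtr0_norm p0) (ger0_norm q0).
have := ler_wpM2l (ltW p0) h1; have := ler_wpM2l q0 h2; lra.
Qed.

(** One Lindeberg exchange: a centred coin of amplitude [a] is traded for a Gaussian of the same
    variance, that is, for [p * (1 - p) * a ^+ 2] units of heat flow. *)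
Lemma flip_heat (a v r w y : R) : 0 <= a -> 0 < v -> w = (Num.sqrt v)^-1 ->
  `|flip a (fun y => heat v (r - y)) y - heat (v + p * (1 - p) * a ^+ 2) (r - y)|
    <= 16 * (w ^+ 3 + w ^+ 4) * (a ^+ 3 + a ^+ 4).
Proof.
move=> a0 v0 wE; have /andP[p0 p1] := p01.
have w0 : 0 <= w by rewrite wE invr_ge0 sqrtr_ge0.
set h := p * (1 - p) * a ^+ 2.
have q0 : 0 < 1 - p by lra.
have h0 : 0 <= h by rewrite !mulr_ge0 ?sqr_ge0// ltW.
set z := r - y.
have e1 := @heat_taylor_space R v z (- ((1 - p) * a)) w v0 wE.
have e2 := @heat_taylor_space R v z (p * a) w v0 wE.
have e3 := @heat_taylor_time R v z h w v0 h0 wE.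
rewrite /flip.
have -> : r - (y + (1 - p) * a) = z - (1 - p) * a by rewrite /z; ring.
have -> : r - (y - p * a) = z + p * a by rewrite /z; ring.
set G := w ^+ 2 * _ in e1 e2 e3; set D := w * phi (z * w) in e1 e2.
(* The terms in [D] cancel because the coin is centred, those in [G] because p(1-p)^2 + (1-p)p^2 =
   p(1-p) matches [h]. Only the three Taylor remainders are left. *)
rewrite [X in `|X|](_ : _ =
  p * (heat v (z - (1 - p) * a) - heat v z - - ((1 - p) * a) * D
     + (- ((1 - p) * a)) ^+ 2 / 2 * G)
  + (1 - p) * (heat v (z + p * a) - heat v z - p * a * D + (p * a) ^+ 2 / 2 * G)
  - (heat (v + h) z - heat v z + h / 2 * G)); last by rewrite /h; field.
have b3 c : 0 <= c <= 1 -> (c * a) ^+ 3 <= a ^+ 3.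
  by move=> /andP[c0 c1]; rewrite exprMn ler_piMl ?exprn_ge0// exprn_ile1.
have ha : h <= a ^+ 2.
  by rewrite ler_piMl ?sqr_ge0//; nra.
have w3 : 0 <= 16 * w ^+ 3 by rewrite mulr_ge0// exprn_ge0.
have w4 : 0 <= 16 * w ^+ 4 by rewrite mulr_ge0// exprn_ge0.
rewrite normrN (ger0_norm (mulr_ge0 (ltW q0) a0)) in e1.
rewrite (ger0_norm (mulr_ge0 (ltW p0) a0)) in e2.
have q1 : 0 <= 1 - p <= 1 by lra.
have p1' : 0 <= p <= 1 by lra.
have {}e1 := le_trans e1 (ler_wpM2l w3 (b3 _ q1)).
have {}e2 := le_trans e2 (ler_wpM2l w3 (b3 _ p1')).
have h4 : h ^+ 2 <= a ^+ 4 by rewrite (exprM a 2 2) lerXn2r ?nnegrE ?sqr_ge0.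
have {}e3 := le_trans e3 (ler_wpM2l w4 h4).
apply: (@le_trans _ _ (16 * w ^+ 3 * a ^+ 3 + 16 * w ^+ 4 * a ^+ 4)); last first.
  have a3 := exprn_ge0 3 a0; have a4 := exprn_ge0 4 a0.
  have := mulr_ge0 w3 a4; have := mulr_ge0 w4 a3; lra.
move: e1 e2 e3; set X1 := (X in `|X| <= _); set E1 := 16 * w ^+ 3 * _; move=> e1.
set X2 := (X in `|X| <= _); move=> e2.
set X3 := (X in `|X| <= _); set E2 := 16 * w ^+ 4 * _; move=> e3.
exact: convex_norm3.
Qed.

(** [flip] is a convex combination, so it does not amplify earlier errors and the errors add up. The
    variance only grows along the iteration, so the bound at [v0] serves for every step. *)
Lemma iter_flip_heat (a v0 r w : R) n y : 0 <= a -> 0 < v0 -> w = (Num.sqrt v0)^-1 ->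
  `|iter n (flip a) (fun y => heat v0 (r - y)) y
    - heat (v0 + n%:R * (p * (1 - p) * a ^+ 2)) (r - y)|
    <= n%:R * (16 * (w ^+ 3 + w ^+ 4) * (a ^+ 3 + a ^+ 4)).
Proof.
move=> a0 v00 wE; have /andP[p0 p1] := p01.
have w0 : 0 <= w by rewrite wE invr_ge0 sqrtr_ge0.
have h0 : 0 <= p * (1 - p) * a ^+ 2 by rewrite !mulr_ge0 ?sqr_ge0//; lra.
elim: n y => [|n IHn] y.
  by rewrite !mul0r addr0/= subrr normr0.
rewrite iterS.
set v := v0 + n%:R * (p * (1 - p) * a ^+ 2) in IHn *.
have vv : v0 <= v by rewrite lerDl mulr_ge0.
have vp : 0 < v by apply: lt_le_trans vv.
have := @flip_heat a v r (Num.sqrt v)^-1 y a0 vp erefl.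
have -> : v0 + n.+1%:R * (p * (1 - p) * a ^+ 2) = v + p * (1 - p) * a ^+ 2.
  by rewrite /v -natr1; ring.
set C := 16 * (w ^+ 3 + w ^+ 4) * _ in IHn *.
have a34 : 0 <= a ^+ 3 + a ^+ 4 by rewrite addr_ge0// exprn_ge0.
have wv : (Num.sqrt v)^-1 <= w.
  by rewrite wE lef_pV2 ?posrE ?sqrtr_gt0 ?ler_wsqrtr.
have wv0 : 0 <= (Num.sqrt v)^-1 by rewrite invr_ge0 sqrtr_ge0.
move=> /le_trans/(_ (_ : _ <= C)) h.
have {h} : `|flip a (fun y => heat v (r - y)) y - heat (v + p * (1 - p) * a ^+ 2) (r - y)| <= C.
  apply: h; apply: ler_wpM2r => //; apply: ler_wpM2l => //.
  by apply: lerD; apply: lerXn2r.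
rewrite /flip -natr1.
have := IHn (y + (1 - p) * a); have := IHn (y - p * a).
set A2 := iter _ _ _ _; set H2 := heat _ _ => h2.
set A1 := iter _ _ _ _; set H1 := heat _ _ => h1.
set H3 := heat _ _ => h3.
rewrite [X in `|X|](_ : _ = p * (A1 - H1) + (1 - p) * (A2 - H2) -
  (H3 - (p * H1 + (1 - p) * H2))); last by ring.
by rewrite [(n%:R + 1) * C]mulrDl mul1r; apply: convex_norm3 => //; rewrite distrC.
Qed.


Lemma inv_sqrt_cvg0 : (Num.sqrt t%:R)^-1 @[t --> \oo] --> (0 : R).
Proof.
pose u t : R := (Num.sqrt t%:R)^-1; rewrite -/u.
rewrite -(cvg_shiftS u) (_ : (fun t => _) = Num.sqrt \o (fun t : nat => t.+1%:R^-1)); last first.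
  by apply/funext => t; rewrite /u/= sqrtrV.
have h : Num.sqrt (harmonic t) @[t --> \oo] --> Num.sqrt (0 : R).
  apply: continuous_cvg; first exact: sqrt_continuous.
  exact: cvg_harmonic.
by rewrite sqrtr0 in h.
Qed.

(** At most [t] exchanges, each costing O(t^(-3/2)), give a total of O(t^(-1/2)). *)
Lemma flip_error_cvg0 (N : nat -> nat) (b : R) : (forall t, (N t <= t)%N) ->
  (N t)%:R * ((b * (Num.sqrt t%:R)^-1) ^+ 3 + (b * (Num.sqrt t%:R)^-1) ^+ 4)
    @[t --> \oo] --> (0 : R).
Proof.
move=> Nt; pose u t : R := (Num.sqrt t%:R)^-1.
have u0 t : 0 <= u t by rewrite invr_ge0 sqrtr_ge0.
have ucvg : u t @[t --> \oo] --> (0 : R) by exact: inv_sqrt_cvg0.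
apply/norm_cvg0P.
apply: (@squeeze_cvgr _ _ _ _ (cst 0) (fun t => `|b| ^+ 3 * u t + `|b| ^+ 4 * (u t * u t))).
- near=> t; rewrite normr_ge0/= normrM ger0_norm//.
  have [->|t0] := posnP (N t); first by rewrite mul0r addr_ge0// !mulr_ge0// ?exprn_ge0.
  have t1 : 0 < t%:R :> R by rewrite ltr0n (leq_trans t0).
  have tu : t%:R * (u t * u t) = 1.
    by rewrite /u -invfM -expr2 sqr_sqrtr ?ler0n// divff// gt_eqF.
  apply: (@le_trans _ _ (t%:R * (`|b * u t| ^+ 3 + `|b * u t| ^+ 4))).
    apply: ler_pM => //; first by rewrite ler_nat.
    by rewrite -!normrX ler_normD.
  rewrite normrM (ger0_norm (u0 t)) !exprMn.
  rewrite [leLHS](_ : _ = (t%:R * (u t * u t)) *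
    (`|b| ^+ 3 * u t + `|b| ^+ 4 * (u t * u t))); last by ring.
  by rewrite tu mul1r.
- exact: cvg_cst.
have -> : (0 : R) = `|b| ^+ 3 * 0 + `|b| ^+ 4 * (0 * 0) by ring.
by apply: cvgD; (apply: cvgM; first exact: cvg_cst) => //; apply: cvgM.
Unshelve. all: by end_near. Qed.


Theorem de_moivre_laplace (N : nat -> nat) (v r : R) :
  (forall t, (N t <= t)%N) -> 0 < v -> (N t)%:R / t%:R @[t --> \oo] --> v ->
  iter (N t) (flip ((Num.sqrt (p * (1 - p)) * Num.sqrt t%:R)^-1))
    (fun y => (y <= r)%R%:R) 0 @[t --> \oo] --> Phi (r / Num.sqrt v).
Proof.
move=> Nt v0 Nv; have /andP[p0 p1] := p01.
have pq0 : 0 < p * (1 - p) by rewrite mulr_gt0//; lra.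
set s := Num.sqrt (p * (1 - p)); have s0 : 0 < s by rewrite sqrtr_gt0.
pose a t : R := (s * Num.sqrt t%:R)^-1.
have a0 t : 0 <= a t by rewrite invr_ge0 mulr_ge0// sqrtr_ge0.
(* For a fixed smoothing [c] the exchange applies; the starting variance [c ^+ 2] keeps the
   derivatives bounded. *)
have key (c : R) : 0 < c -> forall r',
    iter (N t) (flip (a t)) (fun y => heat (c ^+ 2) (r' - y)) 0
      @[t --> \oo] --> heat (c ^+ 2 + v) r'.
  move=> c0 r'; have c20 : 0 < c ^+ 2 by rewrite exprn_gt0.
  pose w := (Num.sqrt (c ^+ 2))^-1.
  pose H t := heat (c ^+ 2 + (N t)%:R * (p * (1 - p) * a t ^+ 2)) (r' - 0).
  rewrite -[heat _ _]addr0.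
  rewrite (_ : (fun t => iter _ _ _ _) = (fun t => H t +
    (iter (N t) (flip (a t)) (fun y => heat (c ^+ 2) (r' - y)) 0 - H t))); last first.
    by apply/funext => t; rewrite subrKC.
  apply: cvgD.
    rewrite /H subr0.
    apply: (@cvg_comp _ _ _ _ (heat ^~ r')); last first.
      by apply: heat_continuous_time; rewrite addr_gt0.
    apply: cvgD; first exact: cvg_cst.
    apply: cvg_trans Nv; apply: near_eq_cvg; near=> t.
    have t0 : 0 < t%:R :> R by rewrite ltr0n; near: t; exists 1%N.
    rewrite /a exprVn exprMn !sqr_sqrtr ?ltW//; field.
    by rewrite !gt_eqF// subr_gt0.
  apply/cvgr0Pnorm_le => e e0.
  have := @flip_error_cvg0 N s^-1 Nt.
  have C0 : 0 < 16 * (w ^+ 3 + w ^+ 4) + 1.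
    rewrite ltr_wpDl// mulr_ge0// addr_ge0// exprn_ge0// invr_ge0 sqrtr_ge0//.
  move/cvgr0Pnorm_le => /(_ (e / (16 * (w ^+ 3 + w ^+ 4) + 1))).
  rewrite divr_gt0// => /(_ isT); apply: filterS => t.
  rewrite -invfM -/(a t) => h.
  have := @iter_flip_heat (a t) (c ^+ 2) r' w (N t) 0 (a0 t) c20 erefl.
  move=> /le_trans; apply.
  rewrite ler_pdivlMr// in h; apply: le_trans h.
  rewrite mulrCA mulrC; set E := _ * (a t ^+ 3 + _).
  have E0 : 0 <= E by rewrite mulr_ge0// addr_ge0// exprn_ge0.
  by rewrite ger0_norm//; lra.
have heat_v : Phi (r / Num.sqrt v) = heat v r by [].
rewrite heat_v; apply/cvgrPdist_le => e e0.
have e30 : 0 < e / 3 by rewrite divr_gt0.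
(* [L] makes the Gaussian tails small and is chosen before [c], because the shift [c * L] has to be
   small as well. *)
have [L [L1 L2]] : exists L : R, 1 - Phi L <= e / 3 /\ Phi (- L) <= e / 3.
  have := @normal_cdf_cvgy R 1; move/cvgrPdist_le => /(_ _ e30)[A [_ hA]].
  have := @normal_cdf_cvgNy R 1; move/cvgrPdist_le => /(_ _ e30)[B [_ hB]].
  exists (Num.max (A + 1) (- (B - 1))); split.
    apply: le_trans (hA _ _); first exact: ler_norm.
    by rewrite lt_max ltrDl ltr01.
  apply: le_trans (hB _ _); first by rewrite sub0r normrN; exact: ler_norm.
  by rewrite oppr_max opprK gt_min; apply/orP; right; lra.
have [c [c0 cu cl]] : exists c : R, [/\ 0 < c,
    heat (c ^+ 2 + v) (r + c * L) <= heat v r + e / 3 &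
    heat v r - e / 3 <= heat (c ^+ 2 + v) (r + c * - L)].
  have /cvgrPdist_le/(_ _ e30) h1 := cvg_at_right_filter (@heat_continuous_shift R v r L v0).
  have /cvgrPdist_le/(_ _ e30) h2 := cvg_at_right_filter (@heat_continuous_shift R v r (- L) v0).
  near (0 : R)^'+ => c; exists c; split; first by near: c; exact: nbhs_right_gt.
    have : `|heat v r - heat (c ^+ 2 + v) (r + c * L)| <= e / 3 by near: c.
    rewrite ler_norml; lra.
  have : `|heat v r - heat (c ^+ 2 + v) (r + c * - L)| <= e / 3 by near: c.
  rewrite ler_norml; lra.
have k1 := key c c0 (r + c * L); have k2 := key c c0 (r - c * L).
move/cvgrPdist_le : k1 => /(_ _ e30) k1; move/cvgrPdist_le : k2 => /(_ _ e30) k2.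
near=> t.
have : `|heat (c ^+ 2 + v) (r + c * L) -
  iter (N t) (flip (a t)) (fun y => heat (c ^+ 2) (r + c * L - y)) 0| <= e / 3.
  by near: t.
have : `|heat (c ^+ 2 + v) (r - c * L) -
  iter (N t) (flip (a t)) (fun y => heat (c ^+ 2) (r - c * L - y)) 0| <= e / 3.
  by near: t.
have := @iter_flip_le (a t) _ _ (N t) (fun y => @heat_indicator_ub R c L r y c0) 0.
have := @iter_flip_le (a t) _ _ (N t) (fun y => @heat_indicator_lb R c L r y c0) 0.
rewrite mulrN in cl; rewrite !iter_flipDc -/(a t).
rewrite !ler_norml => ? ? /andP[? ?] /andP[? ?]; apply/andP; split; lra.
Unshelve. all: by end_near. Qed.

End Flip.

(** * Finite families of Bernoulli variables *)

Section BernoulliExpectation.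
Context {R : realType}.
Variable p : R.

(** Expectation over [n] independent coins, computed by conditioning on the first one. This makes it
    a finite sum with the same recursion as [flip]; [P_coins] connects it to [P]. *)
Fixpoint bexp (n : nat) (f : seq bool -> R) : R :=
  if n is n'.+1 then
    p * bexp n' (fun c => f (true :: c)) + (1 - p) * bexp n' (fun c => f (false :: c))
  else f [::].

Lemma eq_bexp n f g : (forall c, size c = n -> f c = g c) -> bexp n f = bexp n g.
Proof.
elim: n f g => [|n IHn] f g fg /=; first exact: fg.
by congr (_ * _ + _ * _); apply: IHn => c cn; apply: fg; rewrite /= cn.
Qed.

Lemma bexpZ n k f : bexp n (fun c => k * f c) = k * bexp n f.
Proof. by elim: n f => //= n IHn f; rewrite !IHn; ring. Qed.

Lemma bexpB n f g : bexp n (fun c => f c - g c) = bexp n f - bexp n g.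
Proof. by elim: n f g => //= n IHn f g; rewrite !IHn; ring. Qed.

Lemma bexp_cat n1 n2 f g :
  bexp (n1 + n2) (fun c => f (take n1 c) * g (drop n1 c)) = bexp n1 f * bexp n2 g.
Proof.
elim: n1 f => [|n1 IHn] f /=.
  by rewrite -bexpZ; apply: eq_bexp => c _; rewrite take0 drop0.
by rewrite (IHn (fun c => f (true :: c))) (IHn (fun c => f (false :: c))); ring.
Qed.

Definition centered (c : seq bool) : R := \sum_(b <- c) (b%:R - p).

Lemma bexp_flip n (a y : R) (f : R -> R) :
  bexp n (fun c => f (y + a * centered c)) = iter n (flip p a) f y.
Proof.
elim: n y => [|n IHn] y; first by rewrite /= /centered big_nil mulr0 addr0.
rewrite iterS /= /flip -!IHn; congr (_ * _ + _ * _); apply: eq_bexp => c _;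
  by congr f; rewrite /centered big_cons ?mulr1n ?mulr0n; ring.
Qed.

Hypothesis p01 : 0 < p < 1.

Lemma bexp_le n f g : (forall c, f c <= g c) -> bexp n f <= bexp n g.
Proof.
move=> fg; have /andP[p0 p1] := p01; elim: n f g fg => //= n IHn f g fg.
by apply: lerD; apply: ler_wpM2l; [lra|exact: IHn|lra|exact: IHn].
Qed.

Lemma bexp_cst n k : bexp n (fun=> k) = k.
Proof. by elim: n => //= n ->; ring. Qed.

(** The centred walk from [y] leaves [-l, l] at some time, time 0 included. Testing the current
    position first makes the one-step analysis follow the recursion of [bexp]. *)
Fixpoint hits (l y : R) (c : seq bool) : bool :=
  (l < `|y|) || (if c is b :: c' then hits l (y + (b%:R - p)) c' else false).

Lemma hitsN (l y : R) c : ~~ hits l y c ->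
  forall j, (j <= size c)%N -> `|y + centered (take j c)| <= l.
Proof.
elim: c y => [|b c IHc] y /=; rewrite negb_or -leNgt => /andP[yl h] [|j] //=.
- by rewrite /centered big_nil addr0.
- by rewrite /centered big_nil addr0.
by rewrite ltnS /centered big_cons addrA; exact: IHc.
Qed.

(* The bound is a supermartingale in space-time dominating the indicator of
   [l < `|y|], by the moments of a single step. *)
Lemma bexp_hits n (l y : R) : 0 < l ->
  bexp n (fun c => (hits l y c)%:R) <= (y ^+ 4 + 8 * n%:R * y ^+ 2 + 8 * n%:R ^+ 2) / l ^+ 4.
Proof.
move=> l0; have /andP[p0 p1] := p01.
have l40 : 0 < l ^+ 4 by rewrite exprn_gt0.
elim: n y => [|n IHn] y.
  rewrite /= orbF; case: ltP => ly /=; rewrite ?mulr1n ?mulr0n.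
    rewrite ler_pdivlMr// mul1r expr0n/= !mulr0 mul0r !addr0.
    by rewrite -[y ^+ 4]ger0_norm ?exprn_even_ge0// normrX lerXn2r ?nnegrE ?(ltW l0)// ltW.
  by rewrite divr_ge0 ?(ltW l40)// expr0n/= !mulr0 mul0r !addr0 exprn_even_ge0.
have [ly|ly] := ltP l `|y|.
  apply: (@le_trans _ _ 1).
    rewrite -[leRHS](bexp_cst n.+1); apply: bexp_le => c.
    by case: hits; rewrite ?mulr1n ?mulr0n.
  rewrite ler_pdivlMr// mul1r -[leLHS]addr0 -addrA lerD//.
    by rewrite -[y ^+ 4]ger0_norm ?exprn_even_ge0// normrX lerXn2r ?nnegrE ?(ltW l0)// ltW.
  by apply: addr_ge0; apply: mulr_ge0; rewrite ?sqr_ge0 ?mulr_ge0.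
(* The supermartingale inequality. The coefficient 8 of y^2 is 6 + 2: the variance term contributes
   at most 6 y^2, and the third-moment term at most 2 y^2 + 2. *)
have step : p * ((y + (1 - p)) ^+ 4 + 8 * n%:R * (y + (1 - p)) ^+ 2 + 8 * n%:R ^+ 2)
    + (1 - p) * ((y - p) ^+ 4 + 8 * n%:R * (y - p) ^+ 2 + 8 * n%:R ^+ 2)
    <= y ^+ 4 + 8 * n.+1%:R * y ^+ 2 + 8 * n.+1%:R ^+ 2.
  rewrite -[n.+1%:R]natr1; have : 0 <= n%:R :> R by []; move: n%:R => N N0.
  set q := 1 - p.
  have s1 : 0 <= p * q <= 1 / 4.
    have := sqr_ge0 (p - 1 / 2); rewrite /q => ?; apply/andP; split; nra.
  rewrite (_ : p * _ + q * _ = y ^+ 4 + 6 * y ^+ 2 * (p * q) + 4 * y * (p * q * (q - p))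
    + p * q * (p ^+ 3 + q ^+ 3) + 8 * N * (y ^+ 2 + p * q) + 8 * N ^+ 2); last by rewrite /q; ring.
  have qp : -1 <= q - p <= 1 by rewrite /q; lra.
  have c3 : 0 <= p ^+ 3 + q ^+ 3 <= 1.
    rewrite (_ : p ^+ 3 + q ^+ 3 = 1 - 3 * (p * q)); last by rewrite /q; ring.
    lra.
  move: (p * q) s1 (q - p) qp (p ^+ 3 + q ^+ 3) c3 => s /andP[s0 s1] d /andP[d0 d1] c /andP[c0 c1].
  have y2 := sqr_ge0 y.
  have e1 : y ^+ 2 * s <= y ^+ 2 by rewrite ler_piMr//; lra.
  have sd : -1 <= s * d <= 1 by apply/andP; split; nra.
  have e2 : 4 * y * (s * d) <= 2 * y ^+ 2 + 2.
    move: (s * d) sd => u /andP[u0 u1].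
    have := sqr_ge0 (y - u); have : u ^+ 2 <= 1 by nra.
    nra.
  have e3 : s * c <= 1 by nra.
  have e4 : N * s <= N by rewrite ler_piMr//; lra.
  nra.
have l40' : 0 <= (l ^+ 4)^-1 by rewrite invr_ge0 ltW.
apply: le_trans (ler_wpM2r l40' step).
rewrite mulrDl -[p * _ / _]mulrA -[(1 - p) * _ / _]mulrA /=; have q0 : 0 <= 1 - p by lra.
rewrite ltNge ly/=; apply: lerD; apply: ler_wpM2l => //; first exact: ltW.
by rewrite add0r; exact: IHn.
Qed.

End BernoulliExpectation.

(** * Events determined by finitely many coins *)

Section BernoulliFamily.
Context {R : realType} {d : measure_display} {T : measurableType d}.
Variables (P : probability T R) (p : R) (I : choiceType) (X : I -> {RV P >-> bool}).
Hypothesis p01 : 0 < p < 1.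
Hypothesis lawX : forall i, distribution P (X i) = bernoulli_prob p :> (set bool -> \bar R).
Hypothesis indX : mutually_independent P (fun i => rv_sigma_algebra (X i)).

Let bern (b : bool) : R := if b then p else 1 - p.

Let P_coin i b : P [set w | X i w = b] = (bern b)%:E.
Proof.
have := congr1 (fun f => f [set b]) (lawX i).
rewrite /distribution /pushforward => ->.
have /andP[p0 p1] := p01.
rewrite bernoulli_probE ?ltW// !diracE.
have inE1 (a c : bool) : (a \in [set c]) = (a == c).
  by apply/idP/eqP; rewrite inE.
by rewrite !inE1; case: b; rewrite /= ?mule1 ?mule0 ?adde0 ?add0e.
Qed.

Let measurable_coin i b : measurable [set w | X i w = b].
Proof.
by rewrite -[X in measurable X]setTI; exact: (@measurable_funPT _ _ _ _ (X i) _ [set b]).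
Qed.

Lemma measurable_coins (s : seq I) (Q : pred (seq bool)) :
  measurable [set w | Q [seq X i w | i <- s]].
Proof.
elim: s Q => [|i s IHs] Q /=.
  by case: (Q [::]); [rewrite (_ : [set _ | _] = setT)|rewrite (_ : [set _ | _] = set0)] => //;
    apply/seteqP; split.
rewrite (_ : [set _ | _] =
  ([set w | X i w = true] `&` [set w | Q (true :: [seq X i w | i <- s])]) `|`
  ([set w | X i w = false] `&` [set w | Q (false :: [seq X i w | i <- s])])).
  by apply: measurableU; apply: measurableI => //;
    [exact: (IHs (fun c => Q (true :: c)))|exact: (IHs (fun c => Q (false :: c)))].
apply/seteqP; split => w /=; first by case: (X i w); [left|right].
by move=> [[-> //]|[-> //]].
Qed.

Let P_cylinder (u : seq (I * bool)) : uniq (unzip1 u) ->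
  P [set w | all (fun ib => X ib.1 w == ib.2) u] = (\prod_(ib <- u) bern ib.2)%:E.
Proof.
move=> uu.
(* Independence wants events indexed by sites, while [u] lists pairs; since sites do not repeat, the
   quantifier ranges over one value of [b]. *)
pose A i := [set w | forall b, (i, b) \in u -> X i w = b].
have AE i b : (i, b) \in u -> A i = [set w | X i w = b].
  move=> ibu; apply/seteqP; split => [w /(_ b ibu)//|w /= Xb b' ib'u].
  rewrite Xb; have := uu; move: ibu ib'u; clear.
  elim: u => //= -[j c] u IHu; rewrite !inE !xpair_eqE => h1 h2 /andP[jn uu].
  have nj b0 : (j, b0) \in u -> false.
    by move=> ju; move: jn; rewrite (_ : j \in unzip1 u)//; apply/mapP; exists (j, b0).
  case/orP: h1 => [/andP[/eqP ij /eqP bc]|h1]; case/orP: h2 => [/andP[/eqP ij' /eqP bc']|h2].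
  - by rewrite bc bc'.
  - by move: h2; rewrite ij => /nj.
  - by move: h1; rewrite ij' => /nj.
  - exact: IHu.
have := indX (s := unzip1 u) (A := A) uu.
rewrite (_ : \bigcap_(i in _) _ = [set w | all (fun ib => X ib.1 w == ib.2) u]); last first.
  apply/seteqP; split => [w h|w /allP h i _ b].
    apply/allP => -[i b] ibu; apply/eqP; apply: (h i _ b ibu) => /=.
    by apply/mapP; exists (i, b).
  by move=> /h/eqP.
move=> -> //.
  rewrite big_map -prodEFin; apply: eq_big_seq => -[i b] ibu /=.
  by rewrite (AE _ _ ibu) P_coin.
move=> i /mapP[[j b] ibu /= ->]; rewrite (AE _ _ ibu).
by exists [set b]; rewrite // setTI.
Qed.

(** The coins of [s] are revealed one at a time. The induction needs the values already revealed,
    recorded in [u], and it ends with a pure cylinder. *)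
Let P_cylinder_coins (u : seq (I * bool)) (s : seq I) (Q : pred (seq bool)) :
  uniq (unzip1 u ++ s) ->
  P ([set w | all (fun ib => X ib.1 w == ib.2) u] `&` [set w | Q [seq X i w | i <- s]])
  = (\prod_(ib <- u) bern ib.2 * bexp p (size s) (fun c => (Q c)%:R))%:E.
Proof.
elim: s u Q => [|i s IHs] u Q uus /=.
  rewrite cats0 in uus; case: (Q [::]).
    by rewrite mulr1 (_ : [set w | is_true true] = setT) ?setIT ?P_cylinder//; apply/seteqP; split.
  by rewrite mulr0 (_ : [set w | is_true false] = set0) ?setI0 ?measure0//; apply/seteqP; split.
have mu v : measurable [set w | all (fun ib => X ib.1 w == ib.2) v].
  elim: v => [|jb v IHv] /=; first by rewrite (_ : [set _ | _] = setT)//; apply/seteqP; split.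
  rewrite (_ : [set _ | _] = [set w | X jb.1 w = jb.2] `&`
    [set w | all (fun ib => X ib.1 w == ib.2) v]); first exact: measurableI.
  by apply/seteqP; split => w /= => [/andP[/eqP]|[/eqP -> ->]].
have Eb b : [set w | all (fun ib => X ib.1 w == ib.2) u] `&`
    [set w | Q (X i w :: [seq X j w | j <- s])] `&` [set w | X i w = b] =
    [set w | all (fun ib => X ib.1 w == ib.2) ((i, b) :: u)] `&`
    [set w | Q (b :: [seq X j w | j <- s])].
  apply/seteqP; split => w /=.
    by move=> [[-> h] /eqP Xb]; rewrite Xb; move/eqP: Xb => <-.
  by move=> [/andP[/eqP Xb ->]]; rewrite Xb.
have ub b : uniq (unzip1 ((i, b) :: u) ++ s).
  by move: uus; rewrite -[i :: s]cat1s uniq_catCA.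
have mQ := @measurable_coins (i :: s) Q.
rewrite [X in P X](_ : _ =
   ([set w | all (fun ib => X ib.1 w == ib.2) u] `&`
    [set w | Q (X i w :: [seq X j w | j <- s])] `&` [set w | X i w = true]) `|`
   ([set w | all (fun ib => X ib.1 w == ib.2) u] `&`
    [set w | Q (X i w :: [seq X j w | j <- s])] `&` [set w | X i w = false])); last first.
  by rewrite -setIUr (_ : _ `|` _ = setT) ?setIT//; apply/seteqP; split => // w _ /=;
     case: (X i w); [left|right].
rewrite measureU; last 3 first.
- by apply: measurableI => //; exact: measurableI.
- by apply: measurableI => //; exact: measurableI.
- by apply/seteqP; split => // w /= [[_ ->] [_]].
have e1 := IHs _ (fun c => Q (true :: c)) (ub true).
have e2 := IHs _ (fun c => Q (false :: c)) (ub false).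
cbv beta in e1, e2; rewrite !Eb.
apply: (etrans (congr2 (fun a b => (a + b)%E) e1 e2)).
rewrite -EFinD !big_cons /=.
by congr EFin; ring.
Qed.

Lemma P_coins (s : seq I) (Q : pred (seq bool)) : uniq s ->
  P [set w | Q [seq X i w | i <- s]] = (bexp p (size s) (fun c => (Q c)%:R))%:E.
Proof.
move=> us; have := @P_cylinder_coins [::] s Q us.
by rewrite big_nil mul1r (_ : [set w | is_true true] = setT) ?setTI//; apply/seteqP; split.
Qed.

(** Disjoint blocks are concatenated into a single duplicate-free sequence of coins, where [P_coins]
    applies, and [bexp_cat] then splits the expectation again. *)
Lemma P_blocks (J : eqType) (js : seq J) (s : J -> seq I) (Q : J -> pred (seq bool)) :
  uniq js -> (forall j, j \in js -> uniq (s j)) ->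
  (forall j j' i, j \in js -> j' \in js -> i \in s j -> i \in s j' -> j = j') ->
  P [set w | all (fun j => Q j [seq X i w | i <- s j]) js] =
    (\prod_(j <- js) bexp p (size (s j)) (fun c => (Q j c)%:R))%:E.
Proof.
move=> ujs us djs.
pose fix Qs (l : seq J) (c : seq bool) {struct l} : bool := if l is j :: l' then
  Q j (take (size (s j)) c) && Qs l' (drop (size (s j)) c) else true.
have uf : uniq (flatten [seq s j | j <- js]).
  elim: js ujs us djs => //= j js IHjs /andP[jn ujs] us djs.
  rewrite cat_uniq us ?mem_head//= IHjs//; last 2 first.
  - by move=> k kjs; apply: us; rewrite inE kjs orbT.
  - by move=> k k' i kjs k'js; apply: djs; rewrite inE ?kjs ?k'js orbT.
  rewrite andbT; apply/hasPn => i /flattenP[_ /mapP[k kjs ->]] ik.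
  apply/negP => ij; move: jn; rewrite (djs j k i) ?kjs// ?mem_head// inE kjs orbT//.
have QE l w : all (fun j => Q j [seq X i w | i <- s j]) l =
    Qs l [seq X i w | i <- flatten [seq s j | j <- l]].
  elim: l => //= j l ->; rewrite map_cat take_size_cat ?drop_size_cat ?size_map//.
under eq_set do rewrite QE.
rewrite P_coins//; congr EFin.
elim: js {ujs us djs uf} => [|j js IHjs] /=; first by rewrite big_nil mulr1n.
rewrite big_cons -IHjs size_cat -bexp_cat; apply: eq_bexp => c _.
by rewrite -natrM mulnb.
Qed.

End BernoulliFamily.

(** * Path representation of oriented digital boiling *)

Section PathSums.
Context {R : realType}.

(** The type of times is left open: integer times for the boiling, indices for the grid, reals for
    the Brownian paths. *)
Fixpoint path_sum {A : Type} (f : nat -> A -> R) (x : nat) (tau : nat -> A) : R :=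
  if x is y.+1 then path_sum f y tau + (f y.+1 (tau y.+1) - f y.+1 (tau y))
  else f 0%N (tau 0%N).

Lemma eq_path_sum (A : Type) (f : nat -> A -> R) x tau tau' :
  (forall i, (i <= x)%N -> tau i = tau' i) ->
  path_sum f x tau = path_sum f x tau'.
Proof.
elim: x => [|x IHx] h /=; first by rewrite h.
rewrite IHx ?h//; last by move=> i ix; apply: h; exact: leqW.
Qed.

(** A path sum evaluates [f] at 2x + 1 places: once for the first component and twice for each of
    the others. *)
Lemma path_sum_dist (A B : Type) (f : nat -> A -> R) (g : nat -> B -> R) x
    (tau : nat -> A) (rho : nat -> B) (e : R) :
  (forall k i, (k <= x)%N -> (i <= x)%N -> `|f k (tau i) - g k (rho i)| <= e) ->
  `|path_sum f x tau - path_sum g x rho| <= (2 * x%:R + 1) * e.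
Proof.
elim: x => [|x IHx] h /=; first by rewrite mulr0 add0r mul1r h.
rewrite [X in `|X|](_ : _ = (path_sum f x tau - path_sum g x rho) +
  ((f x.+1 (tau x.+1) - g x.+1 (rho x.+1)) - (f x.+1 (tau x) - g x.+1 (rho x)))); last by ring.
apply: (le_trans (ler_normD _ _)).
rewrite -[x.+1%:R]natr1.
have -> : (2 * (x%:R + 1) + 1) * e = (2 * x%:R + 1) * e + (e + e) :> R by ring.
apply: lerD.
  by apply: IHx => k i kx ix; apply: h; exact: leqW.
by apply: (le_trans (ler_normB _ _)); apply: lerD; apply: h.
Qed.

(** A drift common to all components telescopes to its value at the final time; this is how the term
    [p * t] is extracted. *)
Lemma path_sumD (A : Type) (f : nat -> A -> R) (c : A -> R) x tau :
  path_sum (fun k a => f k a + c a) x tau = path_sum f x tau + c (tau x).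
Proof. by elim: x => //= x ->; ring. Qed.

End PathSums.

Section BoilingPaths.
Context {R : realType}.
Variable e : nat -> nat -> bool.
Local Notation h := (@odb_height R e).

Definition coin_count (k j : nat) : R := \sum_(0 <= s < j) (e s k)%:R.

Lemma coin_countS k j : coin_count k j.+1 = coin_count k j + (e j k)%:R.
Proof. by rewrite /coin_count big_nat_recr. Qed.

Definition climbing (x : nat) (tau : nat -> nat) :=
  forall i, (i < x)%N -> (tau i <= tau i.+1)%N.

(** Induction on time: the height at [x] either stayed there and gained the last coin, or was copied
    from the left. In the second case the path sum may also count a coin at the new site, which can
    only increase it. *)
Lemma odb_height_ub t x : exists2 tau : nat -> nat, climbing x tau /\ tau x = t &
  (h t x <= (path_sum coin_count x tau)%:E)%E.
Proof.
elim: t x => [|t IHt] x /=.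
  exists (fun=> 0%N) => //; case: x => [|x] /=; last by rewrite leNye.
  by rewrite /coin_count big_nil.
have stay y : exists2 tau : nat -> nat, climbing y tau /\ tau y = t.+1 &
    (h t y + ((e t y)%:R)%:E <= (path_sum coin_count y tau)%:E)%E.
  have [tau [ct tx] htau] := IHt y.
  (* Only the final time moves, from [t] to [t.+1], so exactly the coin [e t y] is added. *)
  pose rho i := if (i < y)%N then tau i else t.+1.
  exists rho.
    split; last by rewrite /rho ltnn.
    move=> i iy; rewrite /rho iy; case: ltnP => iy'; first exact: ct.
    have -> : i = y.-1 by lia.
    have yy : y = y.-1.+1 by lia.
    have := ct y.-1; rewrite -yy tx => /(_ _)/leq_trans; apply; lia.
  apply: (@le_trans _ _ ((path_sum coin_count y tau)%:E + (e t y)%:R%:E)%E).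
    by apply: leeD.
  rewrite -EFinD lee_fin.
  case: y tau ct tx htau @rho => [|y] tau ct tx htau rho /=.
    by rewrite /rho/= tx coin_countS.
  rewrite (@eq_path_sum R _ _ y rho tau); last by move=> i iy; rewrite /rho ltnS iy.
  rewrite /rho ltnn ltnSn tx coin_countS; lra.
rewrite /odb_step; case: ifPn => [hl|_].
  case: x hl => [|x] /= hl; first by rewrite ltNge leNye in hl.
  have [tau [ct tx] htau] := stay x; have [tau' [ct' tx'] htau'] := IHt x.
  pose rho i := if (i <= x)%N then tau' i else t.+1.
  exists rho.
    split; last by rewrite /rho ltnn.
    move=> i; rewrite ltnS => ix; rewrite /rho ix; case: ltnP => ix'; first exact: ct'.
    suff -> : i = x by rewrite tx'.
    by lia.
  apply: (le_trans htau'); rewrite lee_fin/=.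
  rewrite (@eq_path_sum R _ _ x rho tau'); last by move=> i iy; rewrite /rho iy.
  by rewrite /rho ltnn leqnn tx' coin_countS; case: (e t x.+1); rewrite ?mulr1n ?mulr0n; lra.
have [tau ctau htau] := stay x; exists tau => //.
by case: (e t x) htau; rewrite ?mulr1n ?mulr0n ?adde0.
Qed.

Lemma odb_height_homo x t s : (t <= s)%N -> (h t x <= h s x)%E.
Proof.
move=> /subnK <-; elim: (s - t)%N => // n IHn; apply: (le_trans IHn).
rewrite addSn /= /odb_step; case: ifPn => [/ltW//|_]; case: ifP => // _.
by rewrite leeDl.
Qed.

Lemma odb_height_natural t x : h t x = -oo%E \/ exists n : nat, h t x = n%:R%:E.
Proof.
elim: t x => [|t IHt] [|x] /=; [by right; exists 0%N|by left| |].
  rewrite /odb_step/= ltNge leNye/=; case: (e t 0%N) => //.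
  case: (IHt 0%N) => [->|[n ->]]; first by left.
  by right; exists n.+1; rewrite -natr1.
rewrite /odb_step/=; case: ifP => // _; case: (e t x.+1) => //.
case: (IHt x.+1) => [->|[n ->]]; first by left.
by right; exists n.+1; rewrite -natr1.
Qed.

(** Even when the coin is ignored, the height grows enough: finite heights are integers, so a left
    neighbour that is strictly higher is higher by at least 1. *)
Lemma odb_height_coin t x : (h t x + ((e t x)%:R)%:E <= h t.+1 x)%E.
Proof.
rewrite /= /odb_step; case: ifPn => [|_]; last first.
  by case: (e _ x); rewrite ?mulr1n ?mulr0n ?adde0.
case: x => [|x] /= hl; first by rewrite ltNge leNye in hl.
move: hl.
case: (odb_height_natural t x.+1) => [->|[n ->]]; first by rewrite addNye leNye.
case: (odb_height_natural t x) => [->|[n' ->]]; first by rewrite ltNge leNye.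
rewrite lte_fin ltr_nat => nn'; rewrite lee_fin.
case: (e t x.+1); rewrite ?mulr1n ?mulr0n ?addr0 ?natr1 ler_nat//; exact: ltnW.
Qed.

Lemma odb_height_stay x t n :
  (h t x + (coin_count x (t + n) - coin_count x t)%:E <= h (t + n) x)%E.
Proof.
elim: n => [|n IHn]; first by rewrite addn0 subrr adde0.
rewrite addnS coin_countS.
have -> : coin_count x (t + n) + (e (t + n)%N x)%:R - coin_count x t =
  coin_count x (t + n) - coin_count x t + (e (t + n)%N x)%:R by ring.
rewrite EFinD addeA; apply: (le_trans (leeD2r _ IHn)).
exact: odb_height_coin.
Qed.

Lemma odb_height_climb t x : (h t x <= h t.+1 x.+1)%E.
Proof.
rewrite /= /odb_step/=; case: ifPn => //; rewrite -leNgt => hx.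
by case: (e _ _) => //; apply: (le_trans hx); rewrite leeDl.
Qed.

Lemma coin_count_dist k i j : (i <= j)%N ->
  0 <= coin_count k j - coin_count k i <= (j - i)%:R.
Proof.
move=> /subnK <-; elim: (j - i)%N => [|n IHn].
  by rewrite add0n subrr subnn lexx.
rewrite addSn coin_countS; move: IHn; rewrite -addSn !addnK -[n.+1%:R]natr1.
by case: (e _ _); rewrite ?mulr1n ?mulr0n; lra.
Qed.

(** Each climb consumes a time step, so the path reaches site i with a delay of i. The delay shifts
    the interval of coins read at site i and loses at most i of them; these losses sum to at most
    x^2. *)
Lemma odb_height_lb x tau : climbing x tau ->
  ((path_sum coin_count x tau - x%:R ^+ 2)%:E <= h (tau x + x) x)%E.
Proof.
elim: x tau => [|x IHx] tau ct /=.
  rewrite addn0 expr0n/= subr0.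
  have := odb_height_stay 0%N 0%N (tau 0%N); rewrite add0n /= add0e.
  by rewrite {2}/coin_count big_nil subr0.
have {}IHx := IHx tau (fun i ix => ct i (leqW ix)).
have {}ct := ct x (ltnSn x).
have h1 := le_trans IHx (odb_height_climb _ _).
have := odb_height_stay x.+1 (tau x + x).+1 (tau x.+1 - tau x).
have -> : ((tau x + x).+1 + (tau x.+1 - tau x) = tau x.+1 + x.+1)%N by lia.
apply: le_trans; apply: le_trans (leeD2r _ h1); rewrite -EFinD lee_fin.
have /andP[_ c1] := @coin_count_dist x.+1 (tau x) (tau x + x).+1 (leqW (leq_addr _ _)).
have /andP[c2 _] := @coin_count_dist x.+1 (tau x.+1) (tau x.+1 + x.+1) (leq_addr _ _).
have e1 : ((tau x + x).+1 - tau x = x.+1)%N by lia.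
rewrite e1 in c1; rewrite -[x.+1%:R]natr1 in c1 *.
have x0 : 0 <= x%:R :> R by [].
nra.
Qed.

End BoilingPaths.

(** * Heights against path sums on a coarse grid of times *)

Section GridComparison.
Context {R : realType}.

(** The maximum over climbing sequences ending at [m] is at most [r], stated without forming the
    maximum. *)
Definition grid_le (x m : nat) (F : nat -> nat -> R) (r : R) :=
  forall tau : nat -> nat, climbing x tau -> tau x = m -> path_sum F x tau <= r.

Lemma climbing_le x tau : climbing x tau ->
  forall i j, (i <= j)%N -> (j <= x)%N -> (tau i <= tau j)%N.
Proof.
move=> ct i j /subnK <-; elim: (j - i)%N => // k IHk.
by rewrite addSn => kx; apply: leq_trans (ct _ kx); apply: IHk; exact: ltnW.
Qed.

Lemma grid_le_dist x m (F G : nat -> nat -> R) (r e : R) : (0 < m)%N ->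
  (forall k i, (k <= x)%N -> (i <= m)%N -> `|F k i - G k i| <= e) ->
  grid_le x m F r -> grid_le x m G (r + (2 * x%:R + 1) * e).
Proof.
move=> m0 FG gF tau ct tx; have := gF tau ct tx.
have : `|path_sum F x tau - path_sum G x tau| <= (2 * x%:R + 1) * e.
  apply: path_sum_dist => k i kx ix; apply: FG => //.
  by rewrite -tx; exact: (climbing_le ct ix (leqnn _)).
rewrite ler_norml; lra.
Qed.

Variables (e : nat -> nat -> bool) (p : R) (x m n t : nat).
Hypotheses (p01 : 0 < p < 1) (m0 : (0 < m)%N) (n0 : (0 < n)%N).
(** The [m] blocks of length [n] leave [x] steps for the delays in [odb_height_lb] and up to [m]
    steps for the remainder of a division by [m]. *)
Hypotheses (nt : (n * m + x <= t)%N) (tn : (t <= n * m + x + m)%N).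
Local Notation h := (@odb_height R e).

Definition walk (k j : nat) : R := coin_count e k j - p * j%:R.

Let path_sum_coin tau :
  path_sum (coin_count e) x tau = path_sum walk x tau + p * (tau x)%:R.
Proof.
rewrite -(path_sumD walk (fun a => p * a%:R)); congr (path_sum _ _ _).
by apply/funext => k; apply/funext => a; rewrite /walk subrK.
Qed.

Lemma walk_dist k i j : (i <= j)%N -> `|walk k j - walk k i| <= (j - i)%:R.
Proof.
move=> ij; have /andP[p0 p1] := p01; have := @coin_count_dist R e k _ _ ij.
rewrite natrB// /walk ler_norml.
have : 0 <= j%:R - i%:R :> R by rewrite subr_ge0 ler_nat.
set d := j%:R - i%:R => d0 /andP[c0 c1].
have -> : coin_count e k j - p * j%:R - (coin_count e k i - p * i%:R) =
  (coin_count e k j - coin_count e k i) - p * d by rewrite /d; ring.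
by apply/andP; split; nra.
Qed.

(** Grid sequences are special climbing sequences, so no control inside the blocks is needed. The
    error is x^2 from the delays plus the drift over at most x + m steps. *)
Lemma grid_le_of_height r : (h t x <= (p * t%:R + r)%:E)%E ->
  grid_le x m (fun k i => walk k (n * i)) (r + x%:R ^+ 2 + m%:R + x%:R).
Proof.
move=> hr tau ct tx; have /andP[p0 p1] := p01.
have ct' : climbing x (fun i => n * tau i)%N.
  by move=> i ix; rewrite leq_mul2l ct// orbT.
have := @odb_height_lb R e x _ ct'; rewrite tx.
move=> /le_trans/(_ (odb_height_homo _ _ nt))/le_trans/(_ hr).
rewrite path_sum_coin tx lee_fin.
have -> : path_sum walk x (fun i => (n * tau i)%N) =
  path_sum (fun k i => walk k (n * i)) x tau by elim: (x) => //= y ->.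
have : t%:R <= (n * m)%:R + x%:R + m%:R :> R by rewrite -!natrD ler_nat.
have : 0 <= x%:R :> R by []; have : 0 <= m%:R :> R by [].
move: (_ ^+ 2) (path_sum _ _ _) => a b; nra.
Qed.

Definition small_blocks (l : R) := forall k i j, (k <= x)%N -> (i < m)%N ->
  (j <= n)%N -> `|walk k (n * i + j) - walk k (n * i)| <= l.

(** A climbing sequence for the height is rounded to block boundaries; each evaluation of a walk
    changes by at most [l] inside a block, or [m + x] after the last one. *)
Lemma height_of_grid_le r l : small_blocks l -> 0 <= l ->
  grid_le x m (fun k i => walk k (n * i)) r ->
  (h t x <= (p * t%:R + (r + (2 * x%:R + 1) * (l + m%:R + x%:R)))%:E)%E.
Proof.
move=> sl l0 gr; have [tau [ct tx] htau] := @odb_height_ub R e t x.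
apply: (le_trans htau); rewrite lee_fin path_sum_coin tx addrC lerD2l.
(* Rounding down is monotone, the cap at [m] handles times after the last block, and the final time
   is forced to [m]. *)
pose rho i := if (i < x)%N then minn (tau i %/ n) m else m.
have crho : climbing x rho.
  move=> i ix; rewrite /rho ix; case: ltnP => _; last exact: geq_minr.
  by rewrite leq_min geq_minr andbT; apply: leq_trans (geq_minl _ _) _;
    apply: leq_div2r; exact: ct.
have rx : rho x = m by rewrite /rho ltnn.
have := gr rho crho rx.
have : `|path_sum walk x tau - path_sum (fun k i => walk k (n * i)) x rho|
    <= (2 * x%:R + 1) * (l + m%:R + x%:R).
  apply: path_sum_dist => k i kx ix.
  have mx0 : 0 <= m%:R + x%:R :> R by rewrite addr_ge0.
  have tauit : (tau i <= t)%N by rewrite -tx; exact: (climbing_le ct ix (leqnn _)).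
  have last : (n * m <= tau i)%N -> `|walk k (tau i) - walk k (n * m)| <= l + m%:R + x%:R.
    move=> le; apply: (le_trans (walk_dist k le)).
    rewrite -addrA; apply: (@le_trans _ _ (m%:R + x%:R)); last by rewrite lerDr.
    by rewrite -natrD ler_nat; lia.
  rewrite /rho; case: ltnP => ix'; last first.
    by apply: last; rewrite (_ : i = x) ?tx; lia.
  have [lt|le] := ltnP (tau i %/ n) m; last first.
    apply: last.
    by rewrite mulnC; apply: leq_trans (leq_trunc_div (tau i) n); rewrite leq_mul2r le orbT.
  rewrite -[l + _ + _]addrA; apply: (@le_trans _ _ l); last by rewrite lerDl.
  rewrite {1}(divn_eq (tau i) n) mulnC; apply: sl => //.
  by rewrite ltnW// ltn_mod.
rewrite ler_norml => /andP[_ ub] lb; move: ub lb.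
by move: (path_sum _ _ _) (path_sum _ _ _) ((2 * x%:R + 1) * _) => a b c; lra.
Qed.

End GridComparison.

(** * Convergence of Lipschitz functionals from convergence on boxes *)

Section RealProbability.
Context {R : realType} {d : measure_display} {T : measurableType d}.
Variable P : probability T R.

Definition pr (A : set T) : R := fine (P A).

Lemma prE A : measurable A -> P A = (pr A)%:E.
Proof. by move=> mA; rewrite /pr fineK// fin_num_measure. Qed.

Lemma pr_le A B : measurable A -> measurable B -> A `<=` B -> pr A <= pr B.
Proof.
by move=> mA mB AB; rewrite -lee_fin -!prE//; apply: le_measure; rewrite ?inE.
Qed.

Lemma prU_le A B : measurable A -> measurable B -> pr (A `|` B) <= pr A + pr B.
Proof.
move=> mA mB; rewrite -lee_fin EFinD -!prE//; last exact: measurableU.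
exact: measureU2.
Qed.

Lemma prU A B : measurable A -> measurable B -> A `&` B = set0 ->
  pr (A `|` B) = pr A + pr B.
Proof.
move=> mA mB AB; apply/EFin_inj; rewrite EFinD -!prE//; last exact: measurableU.
exact: measureU.
Qed.

Lemma pr0 : pr set0 = 0. Proof. by rewrite /pr measure0. Qed.

Lemma prC A : measurable A -> pr (~` A) = 1 - pr A.
Proof.
move=> mA; apply/EFin_inj; rewrite EFinB -!prE//; last exact: measurableC.
exact: probability_setC.
Qed.

Lemma measurable_exists (J : eqType) (s : seq J) (F : J -> set T) :
  (forall j, j \in s -> measurable (F j)) ->
  measurable [set w | exists2 j, j \in s & F j w].
Proof.
elim: s => [|j s IHs] mF.
  by rewrite (_ : [set _ | _] = set0)//; apply/seteqP; split => // w [].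
rewrite (_ : [set _ | _] = F j `|` [set w | exists2 j, j \in s & F j w]).
  apply: measurableU; first by apply: mF; rewrite mem_head.
  by apply: IHs => k ks; apply: mF; rewrite inE ks orbT.
apply/seteqP; split => w /=.
  by move=> [k]; rewrite inE => /orP[/eqP -> |ks Fk]; [left|right; exists k].
move=> [Fj|[k ks Fk]]; first by exists j => //; rewrite mem_head.
by exists k => //; rewrite inE ks orbT.
Qed.

Let exists_cons (J : eqType) j (s : seq J) (F : J -> set T) :
  [set w | exists2 k, k \in j :: s & F k w] =
  F j `|` [set w | exists2 k, k \in s & F k w].
Proof.
apply/seteqP; split => w /=.
  by move=> [k]; rewrite inE => /orP[/eqP -> |ks Fk]; [left|right; exists k].
move=> [Fj|[k ks Fk]]; first by exists j => //; rewrite mem_head.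
by exists k => //; rewrite inE ks orbT.
Qed.

Lemma pr_exists_le (J : eqType) (s : seq J) (F : J -> set T) :
  (forall j, j \in s -> measurable (F j)) ->
  pr [set w | exists2 j, j \in s & F j w] <= \sum_(j <- s) pr (F j).
Proof.
elim: s => [|j s IHs] mF.
  rewrite big_nil (_ : [set _ | _] = set0) ?pr0//.
  by apply/seteqP; split => // w [].
have mFs k : k \in s -> measurable (F k).
  by move=> ks; apply: mF; rewrite inE ks orbT.
rewrite exists_cons big_cons; apply: (le_trans (prU_le _ _)).
- by apply: mF; rewrite mem_head.
- exact: measurable_exists.
by rewrite lerD2l IHs.
Qed.

Lemma pr_exists (J : eqType) (s : seq J) (F : J -> set T) : uniq s ->
  (forall j, j \in s -> measurable (F j)) ->
  (forall j k w, F j w -> F k w -> j = k) ->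
  pr [set w | exists2 j, j \in s & F j w] = \sum_(j <- s) pr (F j).
Proof.
move=> + + tF; elim: s => [|j s IHs] /= us mF.
  rewrite big_nil (_ : [set _ | _] = set0) ?pr0//.
  by apply/seteqP; split => // w [].
have mFs k : k \in s -> measurable (F k).
  by move=> ks; apply: mF; rewrite inE ks orbT.
move/andP: us => [js us].
rewrite exists_cons big_cons prU ?IHs//.
- by apply: mF; rewrite mem_head.
- exact: measurable_exists.
apply/seteqP; split => // w [/= Fj [k ks Fk]].
by move: js; rewrite (tF _ _ _ Fj Fk) ks.
Qed.

Lemma measurable_forall (I : finType) (F : I -> set T) :
  (forall i, measurable (F i)) -> measurable [set w | forall i, F i w].
Proof.
move=> mF; rewrite -[X in measurable X]setCK; apply: measurableC.
rewrite (_ : ~` _ = [set w | exists2 i, i \in enum I & (~` F i) w]).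
  by apply: measurable_exists => i _; exact: measurableC.
apply/seteqP; split => w /=.
  by move=> /existsNP[i Fi]; exists i => //; rewrite mem_enum.
by move=> [i _ Fi] /(_ i).
Qed.

End RealProbability.

Section Cells.
Context {R : realType} {I : finType}.

Definition in_box {T : Type} (U : I -> T -> R) (a b : I -> R) : set T :=
  [set w | forall i, a i < U i w <= b i].

Lemma measurable_in_box {d : measure_display} {T : measurableType d}
    (U : I -> T -> R) (a b : I -> R) :
  (forall i, measurable_fun setT (U i)) -> measurable (in_box U a b).
Proof.
move=> mU; apply: measurable_forall => i.
rewrite [X in measurable X](_ : _ = U i @^-1` `]a i, b i]); last first.
  by apply/seteqP; split => w /=; rewrite in_itv.
by rewrite -[X in measurable X]setTI; exact: mU.
Qed.

(** [E z r] stands for a functional of [z] being at most [r]; here [C] is the whole increase of the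
    threshold allowed for one mesh [eta]. *)
Variables (K : nat) (L eta C : R) (E : (I -> R) -> R -> Prop).
Hypothesis eta0 : 0 < eta.
Hypothesis lipE : forall z z' r, (forall i, `|z i - z' i| <= eta) -> E z r -> E z' (r + C).

Let lo (c : {ffun I -> 'I_K}) i : R := - L + (c i)%:R * eta.
Let hi (c : {ffun I -> 'I_K}) i : R := - L + (c i).+1%:R * eta.

Lemma cell_exists (u : R) n : - L < u <= - L + n%:R * eta ->
  exists2 j, (j < n)%N & - L + j%:R * eta < u <= - L + j.+1%:R * eta.
Proof.
elim: n => [|n IHn] /andP[Lu un]; first by move: un; rewrite mul0r; lra.
have [un'|un'] := leP u (- L + n%:R * eta); last by exists n => //; rewrite un'.
have [|j jn ju] := IHn; first by rewrite Lu.
by exists j => //; exact: ltnW.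
Qed.

(** The event for [U] is covered by the cells meeting it and the outside of the big box; on those
    cells [V] satisfies the event with threshold [r + C]. The two sides have the same form, so the
    lemma can be used in both directions. *)
Lemma cell_comparison {d1 d2 : measure_display} {T1 : measurableType d1}
    {T2 : measurableType d2} (P1 : probability T1 R) (P2 : probability T2 R)
    (U : I -> T1 -> R) (V : I -> T2 -> R) (r al be : R) :
  (forall i, measurable_fun setT (U i)) -> (forall i, measurable_fun setT (V i)) ->
  measurable [set w | E (U^~ w) r] -> measurable [set w | E (V^~ w) (r + C)] ->
  0 <= be -> 1 - pr P1 (in_box U (fun=> - L) (fun=> - L + K%:R * eta)) <= al ->
  (forall c, pr P1 (in_box U (lo c) (hi c)) <= pr P2 (in_box V (lo c) (hi c)) + be) ->
  pr P1 [set w | E (U^~ w) r] <=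
    pr P2 [set w | E (V^~ w) (r + C)] + al + #|{ffun I -> 'I_K}|%:R * be.
Proof.
move=> mU mV mEU mEV be0 big cells.
(* Cells are selected by a point of R^I rather than by an outcome, so the selection makes sense on
   both probability spaces. *)
pose S c := `[< exists2 z, (forall i, lo c i < z i <= hi c i) & E z r >].
pose s := [seq c <- enum {ffun I -> 'I_K} | S c].
have near_cell c (z z' : I -> R) : (forall i, lo c i < z i <= hi c i) ->
    (forall i, lo c i < z' i <= hi c i) -> forall i, `|z i - z' i| <= eta.
  move=> h h' i; have := h i; have := h' i; rewrite /lo /hi -natr1 ler_norml.
  by move=> /andP[? ?] /andP[? ?]; apply/andP; split; nra.
have mUc c : measurable (in_box U (lo c) (hi c)) by exact: measurable_in_box.
have mVc c : measurable (in_box V (lo c) (hi c)) by exact: measurable_in_box.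
have mb : measurable (in_box U (fun=> - L) (fun=> - L + K%:R * eta)).
  exact: measurable_in_box.
have mUs : measurable [set w | exists2 c, c \in s & in_box U (lo c) (hi c) w].
  exact: measurable_exists.
have mVs : measurable [set w | exists2 c, c \in s & in_box V (lo c) (hi c) w].
  exact: measurable_exists.
have sub1 : [set w | E (U^~ w) r] `<=` ~` in_box U (fun=> - L) (fun=> - L + K%:R * eta)
    `|` [set w | exists2 c, c \in s & in_box U (lo c) (hi c) w].
  move=> w /= Ew; have [bw|bw] := pselect (in_box U (fun=> - L) (fun=> - L + K%:R * eta) w);
    last by left.
  right.
  have ex i : exists j : 'I_K, - L + j%:R * eta < U i w <= - L + j.+1%:R * eta.
    by have [j jK ju] := cell_exists (bw i); exists (Ordinal jK).
  have [c cw] := choice ex.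
  have cP : in_box U (lo (finfun c)) (hi (finfun c)) w.
    by move=> i; rewrite /lo /hi ffunE; exact: cw.
  exists (finfun c) => //; rewrite mem_filter mem_enum andbT.
  by apply/asboolP; exists (U^~ w).
have sub2 : [set w | exists2 c, c \in s & in_box V (lo c) (hi c) w] `<=`
    [set w | E (V^~ w) (r + C)].
  move=> w [c + cw] /=; rewrite mem_filter => /andP[/asboolP[z zc Ez] _].
  by apply: lipE Ez; exact: near_cell zc cw.
apply: (le_trans (pr_le P1 mEU _ sub1)); first by apply: measurableU => //; exact: measurableC.
apply: (le_trans (prU_le P1 (measurableC mb) mUs)).
rewrite prC//.
have h1 : pr P1 [set w | exists2 c, c \in s & in_box U (lo c) (hi c) w] <=
    \sum_(c <- s) (pr P2 (in_box V (lo c) (hi c)) + be).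
  by apply: (le_trans (pr_exists_le P1 _)) => //; apply: ler_sum.
have ds c c' w : in_box V (lo c) (hi c) w -> in_box V (lo c') (hi c') w -> c = c'.
  move=> h h'; apply/ffunP => i; apply/val_inj/eqP => /=.
  have := h i; have := h' i; rewrite /lo /hi => /andP[a1 a2] /andP[b1 b2].
  have lt1 := lt_le_trans a1 b2; have lt2 := lt_le_trans b1 a2.
  move: lt1 lt2; rewrite !ltrD2l !ltr_pM2r// !ltr_nat !ltnS => le1 le2.
  by rewrite eqn_leq le1 le2.
have h2 : \sum_(c <- s) pr P2 (in_box V (lo c) (hi c)) <= pr P2 [set w | E (V^~ w) (r + C)].
  have us : uniq s by rewrite filter_uniq// enum_uniq.
  rewrite -(pr_exists P2 us (fun c _ => mVc c) ds).
  exact: (pr_le P2 mVs mEV sub2).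
rewrite big_split/= in h1.
have h3 : \sum_(c <- s) be <= #|{ffun I -> 'I_K}|%:R * be.
  rewrite big_const_seq count_predT iter_addr_0 -[be *+ _]mulr_natl ler_wpM2r// ler_nat.
  by rewrite size_filter cardE count_size.
lra.
Qed.

End Cells.

Section BoxConvergence.
Context {R : realType} {I : finType} {d d' : measure_display}.
Context {T : measurableType d} {T' : measurableType d'}.
Variables (P : probability T R) (P' : probability T' R).
Variables (X : nat -> I -> T -> R) (Z : I -> T' -> R).
Hypothesis mX : forall t i, measurable_fun setT (X t i).
Hypothesis mZ : forall i, measurable_fun setT (Z i).
Hypothesis boxXZ : forall a b : I -> R, (forall i, a i <= b i) ->
  pr P (in_box (X t) a b) @[t --> \oo] --> pr P' (in_box Z a b).

Variables (C : R) (E : (I -> R) -> R -> Prop).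
Hypothesis C0 : 0 < C.
Hypothesis lipE : forall z z' r eta, 0 < eta ->
  (forall i, `|z i - z' i| <= eta) -> E z r -> E z' (r + C * eta).
Hypothesis mEX : forall t r, measurable [set w | E ((X t)^~ w) r].
Hypothesis mEZ : forall r, measurable [set w | E (Z^~ w) r].

Lemma big_box (del : R) : 0 < del ->
  exists2 N : nat, (0 < N)%N & 1 - pr P' (in_box Z (fun=> - N%:R) (fun=> N%:R)) <= del.
Proof.
move=> del0.
pose F n := in_box Z (fun=> - n.+1%:R) (fun=> n.+1%:R).
have cF : P' (F n) @[n --> \oo] --> P' (\bigcup_n F n).
  apply: nondecreasing_cvg_mu.
  - by move=> n; exact: measurable_in_box.
  - by apply: bigcup_measurable => n _; exact: measurable_in_box.
  - move=> n m nm; apply/subsetPset => w h i; have /andP[h1 h2] := h i.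
    have nm' : n.+1%:R <= m.+1%:R :> R by rewrite ler_nat.
    by apply/andP; split; [apply: le_lt_trans h1; rewrite lerN2|exact: le_trans nm'].
have FT : \bigcup_n F n = setT.
  apply/seteqP; split => // w _.
  exists (\max_i (Num.bound `|Z i w|)) => // i.
  have : `|Z i w| < (\max_i (Num.bound `|Z i w|)).+1%:R.
    apply: lt_le_trans (archi_boundP (normr_ge0 _)) _; rewrite ler_nat.
    by apply: leqW; exact: (leq_bigmax (F := fun i => Num.bound `|Z i w|)%R i).
  by rewrite ltr_norml => /andP[-> /ltW].
rewrite FT probability_setT in cF.
have {}cF : pr P' (F n) @[n --> \oo] --> (1 : R) by apply: fine_cvg.
move/cvgrPdist_le : cF => /(_ _ del0) [N _ /(_ N (leqnn N)) h].
by exists N.+1 => //; apply: le_trans h; exact: ler_norm.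
Qed.

(** The box size is fixed by tightness of the limit, then the mesh by the Lipschitz constant, then
    the tolerance per cell by the number of cells, and finally [t]. *)
Lemma box_convergence (r del : R) : 0 < del -> \forall t \near \oo,
  pr P [set w | E ((X t)^~ w) r] <= pr P' [set w | E (Z^~ w) (r + del)] + del /\
  pr P' [set w | E (Z^~ w) r] <= pr P [set w | E ((X t)^~ w) (r + del)] + del.
Proof.
move=> del0.
have d40 : 0 < del / 4 by rewrite divr_gt0.
have [N N0 bN] := big_box d40.
have Nr0 : 0 < N%:R :> R by rewrite ltr0n.
pose eta0 := del / C.
have eta00 : 0 < eta0 by rewrite divr_gt0.
have [K K0 Keta] : exists2 K : nat, (0 < K)%N & 2 * N%:R / K%:R <= eta0.
  exists (Num.bound (2 * N%:R / eta0)).+1 => //.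
  rewrite ler_pdivrMr ?ltr0n// [eta0 * _]mulrC -ler_pdivrMr//.
  have b0 : 0 <= 2 * N%:R / eta0 by rewrite divr_ge0 ?(ltW eta00)// mulr_ge0.
  by apply: ltW; apply: (lt_trans (archi_boundP b0)); rewrite ltr_nat.
pose eta : R := 2 * N%:R / K%:R.
have eta_gt0 : 0 < eta by rewrite divr_gt0 ?ltr0n// mulr_gt0.
have KE : - N%:R + K%:R * eta = N%:R.
  by rewrite /eta; field; rewrite pnatr_eq0 -lt0n.
have Ceta : C * eta <= del.
  by rewrite mulrC -ler_pdivlMr.
(* Monotonicity in the threshold is the Lipschitz property with z = z'. *)
have Emon z r1 r2 : r1 < r2 -> E z r1 -> E z r2.
  move=> r12 Ez; have := @lipE z z r1 ((r2 - r1) / C).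
  rewrite [C * _]mulrC divfK ?gt_eqF// subrKC; apply => //; first by rewrite divr_gt0// subr_gt0.
  by move=> i; rewrite subrr normr0 ltW// divr_gt0// subr_gt0.
have lip z z' s : (forall i, `|z i - z' i| <= eta) -> E z s -> E z' (s + del).
  move=> zz' /(lipE eta_gt0 zz').
  by move: Ceta; rewrite le_eqVlt => /predU1P[-> //|lt]; apply: Emon; rewrite ltrD2l.
pose lo (c : {ffun I -> 'I_K}) i : R := - N%:R + (c i)%:R * eta.
pose hi (c : {ffun I -> 'I_K}) i : R := - N%:R + (c i).+1%:R * eta.
pose M : R := #|{ffun I -> 'I_K}|%:R.
have M0 : 0 < M + 1 by rewrite ltr_wpDl.
pose be := del / 2 / (M + 1).
have be0 : 0 < be by rewrite !divr_gt0.
have Mbe : M * be <= del / 2.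
  rewrite /be mulrCA ger_pMr ?divr_gt0// ler_pdivrMr//; lra.
have cv a b : (forall i, a i <= b i) -> forall e, 0 < e -> \forall t \near \oo,
    `|pr P' (in_box Z a b) - pr P (in_box (X t) a b)| <= e.
  by move=> /boxXZ/cvgrPdist_le.
have cells : \forall t \near \oo, forall c : {ffun I -> 'I_K},
    `|pr P' (in_box Z (lo c) (hi c)) - pr P (in_box (X t) (lo c) (hi c))| <= be.
  apply: filter_forall => c; apply: cv => // i.
  by rewrite /lo /hi lerD2l ler_pM2r// ler_nat.
have bigX : \forall t \near \oo,
    `|pr P' (in_box Z (fun=> - N%:R) (fun=> N%:R))
      - pr P (in_box (X t) (fun=> - N%:R) (fun=> N%:R))| <= del / 4.
  by apply: cv => // i; rewrite lerNl; lra.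
near=> t.
have hb : `|pr P' (in_box Z (fun=> - N%:R) (fun=> N%:R))
      - pr P (in_box (X t) (fun=> - N%:R) (fun=> N%:R))| <= del / 4 by near: t.
have hc : forall c : {ffun I -> 'I_K},
    `|pr P' (in_box Z (lo c) (hi c)) - pr P (in_box (X t) (lo c) (hi c))| <= be by near: t.
move: hb; rewrite ler_norml => /andP[hb1 hb2].
split.
  apply: (le_trans (@cell_comparison R I K N%:R eta del E eta_gt0 lip _ _ _ _ P P'
    (X t) Z r (del / 2) be (mX t) mZ (mEX t r) (mEZ _) (ltW be0) _ _)).
  - rewrite KE; lra.
  - by move=> c; have := hc c; rewrite /lo /hi ler_norml => /andP[? ?]; lra.
  - rewrite -/M; lra.
apply: (le_trans (@cell_comparison R I K N%:R eta del E eta_gt0 lip _ _ _ _ P' P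
  Z (X t) r (del / 2) be mZ (mX t) (mEZ r) (mEX t _) (ltW be0) _ _)).
- rewrite KE; lra.
- by move=> c; have := hc c; rewrite /lo /hi ler_norml => /andP[? ?]; lra.
- rewrite -/M; lra.
Unshelve. all: by end_near. Qed.

End BoxConvergence.

(** * Brownian motion on a grid *)

Section GridMeasurability.
Context {R : realType} {d : measure_display} {T : measurableType d}.

Lemma measurable_path_sum (F : nat -> nat -> T -> R) x (tau : nat -> nat) :
  (forall k i, measurable_fun setT (F k i)) ->
  measurable_fun setT (fun w => path_sum (fun k i => F k i w) x tau).
Proof.
move=> mF; elim: x => [|x IHx] /=; first exact: mF.
by apply: measurable_funD => //; apply: measurable_funB.
Qed.

(* A climbing sequence only matters through its first [x.+1] values, which
   leaves countably many constraints. *)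
Lemma measurable_grid_le (F : nat -> nat -> T -> R) x m r :
  (forall k i, measurable_fun setT (F k i)) ->
  measurable [set w | grid_le x m (fun k i => F k i w) r].
Proof.
move=> mF.
pose A (s : seq nat) := [set w | climbing x (nth 0%N s) -> nth 0%N s x = m ->
  path_sum (fun k i => F k i w) x (nth 0%N s) <= r].
have mA s : measurable (A s).
  have [cs|cs] := pselect (climbing x (nth 0%N s) /\ nth 0%N s x = m); last first.
    rewrite (_ : A s = setT)//; apply/seteqP; split => // w _ h1 h2.
    by exfalso; apply: cs.
  rewrite (_ : A s = (fun w => path_sum (fun k i => F k i w) x (nth 0%N s)) @^-1` `]-oo, r]).
    by rewrite -[X in measurable X]setTI; exact: (@measurable_path_sum F x _ mF).
  by apply/seteqP; split => w /=; rewrite in_itv/= => h; [apply: h; case: cs|move=> _ _].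
rewrite (_ : [set w | _] = \bigcap_n (if unpickle n is Some s then A s else setT)).
  by apply: bigcapT_measurable => n; case: unpickle.
apply/seteqP; split => [w h n _|w h tau ct tx].
  by case: (unpickle n) => // s cs sx; exact: h.
have tE i : (i <= x)%N -> nth 0%N (mkseq tau x.+1) i = tau i.
  by move=> ix; rewrite nth_mkseq.
have := h (pickle (mkseq tau x.+1)) I; rewrite pickleK => h'.
rewrite -(@eq_path_sum _ _ _ x _ _ tE); apply: h'; last by rewrite tE.
by move=> i ix; rewrite !tE// ?ct// ltnW.
Qed.

End GridMeasurability.

Section BrownianGrid.
Context {R : realType} {d : measure_display} {T : measurableType d}.
Variables (P : probability T R) (x : nat) (B : 'I_x.+1 -> R -> T -> R).
Hypothesis bmB : brownian_motion_dim P B.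

Lemma path_sumE (A : Type) (f : nat -> A -> R) n (tau : nat -> A) :
  path_sum f n tau =
  f 0%N (tau 0%N) + \sum_(i < n) (f i.+1 (tau i.+1) - f i.+1 (tau i)).
Proof.
elim: n => [|n IHn] /=; first by rewrite big_ord0 addr0.
by rewrite IHn big_ord_recr/= [RHS]addrA.
Qed.

Lemma path_value_sum w t :
  path_value B w t = path_sum (fun k s => B (inord k) s w) x t.
Proof.
rewrite path_sumE /path_value; congr (B _ _ _ + _).
  by apply/val_inj; rewrite /= inordK.
apply: eq_bigr => i _; rewrite (_ : inord i.+1 = lift ord0 i)//.
by apply/val_inj; rewrite /= inordK// ltnS ltn_ord.
Qed.

Definition dyadic_grid (j : nat) (r : R) : set T :=
  [set w | grid_le x (2 ^ j) (fun k i => B (inord k) (i%:R / (2 ^ j)%:R) w) r].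

Lemma measurable_dyadic_grid j r : measurable (dyadic_grid j r).
Proof.
apply: measurable_grid_le => k i; have [bm _] := bmB.
by have [h _ _ _ _] := bm (inord k); apply: h; rewrite divr_ge0.
Qed.

(** Doubling a climbing sequence embeds each dyadic grid in the next one. *)
Lemma dyadic_gridS j r : dyadic_grid j.+1 r `<=` dyadic_grid j r.
Proof.
move=> w h tau ct tx.
have := h (fun i => (2 * tau i)%N).
rewrite tx -expnS => /(_ _ erefl) h'; apply: le_trans (h' _).
  rewrite !path_sumE le_eqVlt; apply/orP; left; apply/eqP.
  have e n : (2 * n)%:R / (2 ^ j.+1)%:R = n%:R / (2 ^ j)%:R :> R.
    by rewrite expnS !natrM; field; rewrite pnatr_eq0 expn_eq0.
  by rewrite e; congr (_ + _); apply: eq_bigr => i _; rewrite !e.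
by move=> i ix; rewrite leq_mul2l/= ct.
Qed.

Lemma brownian_max_grid r :
  [set w | brownian_max B w <= r] = \bigcap_j dyadic_grid j r.
Proof.
apply/seteqP; split => w /=.
  move=> Mr j _ tau ct tx; apply: le_trans Mr.
  have [_ ub] := @brownian_max_attained R _ _ P x B w bmB.
  apply: ub; exists (fun i => (tau i)%:R / (2 ^ j)%:R).
    split; first by rewrite divr_ge0.
      by move=> i ix; rewrite ler_pM2r ?invr_gt0 ?ltr0n ?expn_gt0// ler_nat ct.
    by rewrite tx divff// pnatr_eq0 expn_eq0.
  by rewrite path_value_sum !path_sumE.
move=> h; have [[t [t0 ct tx] <-] _] := @brownian_max_attained R _ _ P x B w bmB.
have tle i : (i <= x)%N -> 0 <= t i.
  elim: i => // i IHi ix; apply: le_trans (ct i ix); apply: IHi; exact: ltnW.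
(* The maximiser is rounded down to the grid. Rounding preserves the order and leaves the final time
   1 exact, so the result is a climbing sequence. *)
pose tau j i := Num.truncn (t i * (2 ^ j)%:R).
pose u j i : R := (tau j i)%:R / (2 ^ j)%:R.
have ub j i : (i <= x)%N -> `|t i - u j i| <= (2 ^ j)%:R^-1.
  move=> ix; have p0 : 0 < (2 ^ j)%:R :> R by rewrite ltr0n expn_gt0.
  have z0 : 0 <= t i * (2 ^ j)%:R by rewrite mulr_ge0// tle.
  have /andP[h1 h2] := Num.Theory.truncn_itv z0.
  rewrite ler_norml; apply/andP; split.
    apply: (@le_trans _ _ 0); first by rewrite oppr_le0 invr_ge0 ltW.
    by rewrite subr_ge0 ler_pdivrMr.
  rewrite lerBlDr -{1}[_^-1]mul1r -mulrDl ler_pdivlMr// -natr1 in h2 *.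
  by rewrite addrC ltW.
have pw : (2 ^ j)%:R^-1 @[j --> \oo] --> (0 : R).
  have := @cvg_geometric R 1 2^-1; rewrite ger0_norm// => /(_ _) h2.
  have {}h2 := h2 (_ : _); rewrite (_ : (fun j => _) = geometric 1 2^-1).
    by apply: h2; lra.
  by apply/funext => j; rewrite /= mul1r natrX exprVn.
have ucvg i : (i <= x)%N -> u j i @[j --> \oo] --> t i.
  move=> ix; apply/cvgrPdist_le => e e0.
  move/cvgr0Pnorm_le : pw => /(_ _ e0); apply: filterS => j.
  by rewrite ger0_norm ?invr_ge0//; apply: le_trans; exact: ub.
have [bm _] := bmB.
have Bcvg k i : (i <= x)%N -> B k (u j i) w @[j --> \oo] --> B k (t i) w.
  move=> ix; have [_ _ cW _ _] := bm k.
  have := @continuous_abs_comp R (fun s => B k s w) (cW w) (t i).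
  move/(cvg_comp _ _ (ucvg i ix)); rewrite /comp ger0_norm ?tle//.
  rewrite (_ : (fun j => B k `|u j i| w) = (fun j => B k (u j i) w))//.
  by apply/funext => j; rewrite ger0_norm// divr_ge0.
have Scvg y : (y <= x)%N -> path_sum (fun k s => B (inord k) s w) y (u j) @[j --> \oo] -->
    path_sum (fun k s => B (inord k) s w) y t.
  elim: y => [|y IHy] yx /=; first exact: Bcvg.
  apply: cvgD; first by apply: IHy; exact: ltnW.
  by apply: cvgB; apply: Bcvg => //; exact: ltnW.
rewrite path_value_sum.
apply: (@closed_cvg _ _ _ _ _ (fun v => v <= r) _ _ _ (Scvg x (leqnn x))).
  exact: closed_le.
near=> j.
have -> : path_sum (fun k s => B (inord k) s w) x (u j) =
    path_sum (fun k i => B (inord k) (i%:R / (2 ^ j)%:R) w) x (tau j).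
  by rewrite !path_sumE.
apply: (h j I) => [i ix|].
  by apply: le_truncn; rewrite ler_pM2r ?ltr0n ?expn_gt0// ct.
by rewrite /tau tx mul1r natrK.
Unshelve. all: by end_near. Qed.

End BrownianGrid.

Section BrownianBoxes.
Context {R : realType} {d : measure_display} {T : measurableType d}.
Variables (P : probability T R) (x m' : nat) (B : 'I_x.+1 -> R -> T -> R).
Hypothesis bmB : brownian_motion_dim P B.
Local Notation m := m'.+1.
Local Notation I := ('I_x.+1 * 'I_m)%type.

Definition increment (ki : I) (w : T) : R :=
  B ki.1 (ki.2.+1%:R / m%:R) w - B ki.1 (ki.2%:R / m%:R) w.

Lemma measurable_increment ki : measurable_fun setT (increment ki).
Proof.
have [bm _] := bmB; have [h _ _ _ _] := bm ki.1.
by apply: measurable_funB; apply: h; rewrite divr_ge0.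
Qed.

Lemma increment_sum w k i : (i <= m)%N ->
  \sum_(0 <= l < i) increment (inord k, inord l) w = B (inord k) (i%:R / m%:R) w.
Proof.
have [bm _] := bmB; have [_ B0 _ _ _] := bm (inord k).
elim: i => [|i IHi] im; first by rewrite big_nil mul0r B0.
rewrite big_nat_recr//= IHi; last exact: ltnW.
by rewrite /increment/= inordK// subrKC.
Qed.

Let v : R := m%:R^-1.

Let pr_increment ki a b : a <= b ->
  pr P [set w | a < increment ki w <= b] = Phi (b / Num.sqrt v) - Phi (a / Num.sqrt v).
Proof.
move=> ab; have [bm _] := bmB; have [_ _ _ hN _] := bm ki.1.
have m0 : 0 < m%:R :> R by rewrite ltr0n.
have st : 0 <= (ki.2%:R / m%:R : R) < ki.2.+1%:R / m%:R.
  by rewrite divr_ge0//= ltr_pM2r ?invr_gt0// ltr_nat.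
have := hN _ _ st `]a, b]%classic (measurable_itv _).
have -> : ki.2.+1%:R / m%:R - ki.2%:R / m%:R = v.
  by rewrite -mulrBl -natr1 addrAC subrr add0r mul1r.
have s0 : 0 < Num.sqrt v by rewrite sqrtr_gt0 invr_gt0.
have -> : ((B ki.1 (ki.2.+1%:R / m%:R) \- B ki.1 (ki.2%:R / m%:R)) @^-1` `]a, b]) =
  [set w | a < increment ki w <= b].
  by apply/seteqP; split => w /=; rewrite in_itv.
move=> h; rewrite /pr [X in fine X]h.
have -> : `]a, b]%classic = `]-oo, b]%classic `\` `]-oo, a]%classic :> set R.
  by rewrite -[RHS]setCK setCD setCitvl setUC -[LHS]setCK setCitv.
rewrite -!normal_cdf_scale//.
suff -> : normal_prob 0 (Num.sqrt v) (`]-oo, b]%classic `\` `]-oo, a]%classic) =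
  ((normal_cdf (Num.sqrt v) b)%:E - (normal_cdf (Num.sqrt v) a)%:E)%E by [].
rewrite -!normal_cdfE measureD//; last by rewrite -ge0_fin_numE// fin_num_measure.
by rewrite setIidr//; exact: subset_itvl.
Qed.

(** Independence of the components is stated for the sigma-algebras they generate, so box events
    must be measurable there and not just in [T']'s role of ambient space; hence the auxiliary
    measurable type [TG]. *)
Let in_process k i a b :
  process_sigma_algebra (B k) [set w | a < increment (k, i) w <= b].
Proof.
pose G := \bigcup_(t in [set t : R | 0 <= t]) rv_sigma_algebra (B k t).
pose TG := g_sigma_algebraType G.
have mB t : 0 <= t -> measurable_fun [set: TG] (B k t : TG -> R).
  move=> t0 _ Y mY; apply: sub_sigma_algebra; exists t => //.
  by exists Y.
have mI : measurable_fun [set: TG] (increment (k, i) : TG -> R).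
  by apply: measurable_funB; apply: mB; rewrite divr_ge0.
have := mI measurableT `]a, b]%classic (measurable_itv _).
rewrite setTI (_ : _ @^-1` _ = [set w | a < increment (k, i) w <= b])//.
Qed.

Let in_process_forall k (a b : I -> R) : process_sigma_algebra (B k)
  [set w | forall i, a (k, i) < increment (k, i) w <= b (k, i)].
Proof.
pose G := \bigcup_(t in [set t : R | 0 <= t]) rv_sigma_algebra (B k t).
exact: (@measurable_forall _ (g_sigma_algebraType G) 'I_m
  (fun i => [set w | a (k, i) < increment (k, i) w <= b (k, i)])
  (fun i => @in_process k i _ _)).
Qed.

Let P_row k (a b : I -> R) : 
  P [set w | forall i, a (k, i) < increment (k, i) w <= b (k, i)] =
  (\prod_(i < m) P [set w | (a (k, i) < increment (k, i) w <= b (k, i))%R])%E.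
Proof.
have [bm _] := bmB; have [_ _ _ _ hI] := bm k.
pose t (n : nat) : R := n%:R / m%:R.
have t0 : 0 <= t 0%N by rewrite divr_ge0.
have tm : nondecreasing_seq t.
  by move=> n1 n2 n12; rewrite ler_pM2r ?invr_gt0 ?ltr0n// ler_nat.
pose A (n : nat) := [set w | a (k, inord n) < increment (k, inord n) w <= b (k, inord n)].
have us : uniq [seq val i | i <- enum 'I_m].
  by rewrite map_inj_uniq ?enum_uniq//; exact: val_inj.
have AE i : A (val i) = [set w | a (k, i) < increment (k, i) w <= b (k, i)].
  by rewrite /A inord_val.
have := hI t t0 tm [seq val i | i <- enum 'I_m] A us.
rewrite (_ : \bigcap_(i in _) A i =
  [set w | forall i, a (k, i) < increment (k, i) w <= b (k, i)]); last first.
  apply/seteqP; split => w h.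
    by move=> i; have := h (val i); rewrite AE; apply; apply: map_f; rewrite mem_enum.
  by move=> _ /mapP[i _ ->]; rewrite AE; exact: h.
move=> ->.
  by rewrite big_map big_enum/=; apply: eq_bigr => i _; rewrite AE.
move=> _ /mapP[i _ ->]; rewrite AE; exists `]a (k, i), b (k, i)]%classic => //.
rewrite setTI; apply/seteqP; split => w /=; rewrite in_itv//.
Qed.

Lemma pr_increment_box (a b : I -> R) : (forall ki, a ki <= b ki) ->
  pr P (in_box increment a b) =
  \prod_(ki : I) (Phi (b ki / Num.sqrt m%:R^-1) - Phi (a ki / Num.sqrt m%:R^-1)).
Proof.
move=> ab; have [_ hI] := bmB.
pose A k := [set w | forall i, a (k, i) < increment (k, i) w <= b (k, i)].
have := hI (enum 'I_x.+1) A (enum_uniq _) (fun k _ => @in_process_forall k a b).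
rewrite (_ : \bigcap_(i in _) A i = in_box increment a b); last first.
  apply/seteqP; split => w h.
    by move=> [k i]; apply: (h k); rewrite /= mem_enum.
  by move=> k _ i; exact: h.
rewrite /pr => ->; rewrite big_enum/=.
rewrite (_ : (\prod_k P (A k))%E = (\prod_(ki : I) (Phi (b ki / Num.sqrt m%:R^-1)
    - Phi (a ki / Num.sqrt m%:R^-1)))%:E)//.
pose f ki := Phi (b ki / Num.sqrt m%:R^-1) - Phi (a ki / Num.sqrt m%:R^-1).
have -> : \prod_(ki : I) f ki = \prod_k \prod_i f (k, i).
  by rewrite pair_bigA; apply: eq_bigr => -[].
rewrite -prodEFin; apply: eq_bigr => k _.
rewrite P_row -prodEFin; apply: eq_bigr => i _.
rewrite prE ?pr_increment//.
rewrite (_ : [set _ | _] = increment (k, i) @^-1` `]a (k, i), b (k, i)]).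
  by rewrite -[X in measurable X]setTI; exact: measurable_increment.
by apply/seteqP; split => w /=; rewrite in_itv.
Qed.

End BrownianBoxes.

(** * Blocks of the walks *)

Lemma cvg_prod_seq {R : realType} (J : Type) (r : seq J) (f : J -> nat -> R) (l : J -> R) :
  (forall j, f j t @[t --> \oo] --> l j) ->
  \prod_(j <- r) f j t @[t --> \oo] --> \prod_(j <- r) l j.
Proof.
move=> fl; elim: r => [|j r IHr].
  by rewrite big_nil; under eq_fun do rewrite big_nil; exact: cvg_cst.
by rewrite big_cons; under eq_fun do rewrite big_cons; exact: cvgM.
Qed.

Section WalkBlocks.
Context {R : realType} {d : measure_display} {T : measurableType d}.
Variables (P : probability T R) (p : R) (eps : nat -> nat -> {RV P >-> bool}).
Hypothesis p01 : 0 < p < 1.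
Hypothesis iid : iid_bernoulli p eps.

Let X (tx : nat * nat) : {RV P >-> bool} := eps tx.1 tx.2.

Definition coins (w : T) (s z : nat) : bool := eps s z w.

Let lawX tx : distribution P (X tx) = bernoulli_prob p :> (set bool -> \bar R).
Proof. by have [h _] := iid; exact: h. Qed.

Let indX : mutually_independent P (fun tx => rv_sigma_algebra (X tx)).
Proof. by have [_] := iid. Qed.

Definition site_block (k s n : nat) : seq (nat * nat) := [seq (l, k) | l <- iota s n].

Lemma walk_centered w k s n : walk (coins w) p k (s + n) - walk (coins w) p k s =
  centered p [seq X i w | i <- site_block k s n].
Proof.
elim: n => [|n IHn]; first by rewrite addn0 subrr /centered big_nil.
rewrite /site_block -addn1 iotaD !map_cat /centered big_cat -/(centered _ _)/=.
rewrite -IHn big_seq1 addn1 addnS /walk coin_countS -[(s + n).+1%:R]natr1 /X/=; ring.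
Qed.

Lemma measurable_coin_fun (s : seq (nat * nat)) (f : seq bool -> R) :
  measurable_fun setT (fun w => f [seq X i w | i <- s]).
Proof.
move=> _ Y mY; rewrite setTI.
rewrite (_ : _ @^-1` _ = [set w | `[< Y (f [seq X i w | i <- s]) >]]).
  exact: (measurable_coins X s (fun c => `[< Y (f c) >])).
by apply/seteqP; split => w /= /asboolP.
Qed.

Lemma measurable_walk k j : measurable_fun setT (fun w => walk (coins w) p k j).
Proof.
rewrite (_ : (fun _ => _) = (fun w => centered p [seq X i w | i <- site_block k 0 j])).
  exact: measurable_coin_fun.
apply/funext => w; rewrite -walk_centered add0n (_ : walk (coins w) p k 0 = 0) ?subr0//.
by rewrite /walk /coin_count big_nil mulr0 subr0.
Qed.

Variables (x m' : nat).
Local Notation m := m'.+1.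
Local Notation I := ('I_x.+1 * 'I_m)%type.

Definition block_increment (n : nat) (a : R) (ki : I) (w : T) : R :=
  a * (walk (coins w) p ki.1 (n * ki.2.+1) - walk (coins w) p ki.1 (n * ki.2)).

Lemma measurable_block_increment n a ki : measurable_fun setT (block_increment n a ki).
Proof.
by apply: measurable_funM => //; apply: measurable_funB; exact: measurable_walk.
Qed.

Lemma block_increment_sum n a w k i : (k <= x)%N -> (i <= m)%N ->
  \sum_(0 <= l < i) block_increment n a (inord k, inord l) w = a * walk (coins w) p k (n * i).
Proof.
move=> kx; elim: i => [|i IHi] im.
  by rewrite big_nil muln0 /walk /coin_count big_nil mulr0 subr0 mulr0.
rewrite big_nat_recr//= IHi; last exact: ltnW.
by rewrite /block_increment/= !inordK//; ring.
Qed.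

Let block n (ki : I) := site_block ki.1 (n * ki.2) n.

Let block_incrementE n a ki w :
  block_increment n a ki w = a * centered p [seq X i w | i <- block n ki].
Proof. by rewrite /block_increment -walk_centered mulnS addnC. Qed.

Lemma pr_block_box n (c : R) (a b : I -> R) :
  pr P (in_box (block_increment n c) a b) =
  \prod_(ki : I) bexp p n (fun s => (a ki < c * centered p s <= b ki)%R%:R).
Proof.
pose Q (ki : I) s := a ki < c * centered p s <= b ki.
have h := @P_blocks R d T P p _ X p01 lawX indX I (enum {: I}) (block n) Q (enum_uniq _).
rewrite (_ : in_box _ _ _ =
    [set w | all (fun ki => Q ki [seq X i w | i <- block n ki]) (enum {: I})]); last first.
  apply/seteqP; split => w /=.
    by move=> hw; apply/allP => ki _; have := hw ki; rewrite block_incrementE.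
  by move=> /allP hw ki; have := hw ki (mem_enum _ ki); rewrite /Q -block_incrementE.
rewrite /pr h ?big_enum/=.
- by apply: eq_bigr => ki _; rewrite /block size_map size_iota.
- move=> ki _; rewrite map_inj_uniq ?iota_uniq// => l l' []//.
move=> [k i] [k' i'] _ _ _ /mapP[l + ->] /mapP[l' + [ll' kk']].
rewrite -ll' !mem_iota/= => /andP[h1 h2] /andP[h3 h4].
congr pair; first exact: val_inj.
by apply: val_inj => /=; nia.
Qed.

(** The probability factorises over blocks, and each half-open interval is a difference of two
    half-lines, to which [de_moivre_laplace] applies. *)
Lemma pr_block_box_cvg (N : nat -> nat) (a b : I -> R) :
  (forall t, (N t <= t)%N) -> (N t)%:R / t%:R @[t --> \oo] --> (m%:R^-1 : R) ->
  (forall ki, a ki <= b ki) ->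
  pr P (in_box (block_increment (N t) (Num.sqrt (p * (1 - p)) * Num.sqrt t%:R)^-1) a b)
    @[t --> \oo] -->
  \prod_(ki : I) (Phi (b ki / Num.sqrt m%:R^-1) - Phi (a ki / Num.sqrt m%:R^-1)).
Proof.
move=> Nt Nv ab.
have m0 : 0 < m%:R^-1 :> R by rewrite invr_gt0 ltr0n.
rewrite (_ : (fun t => _) = fun t => \prod_(ki : I)
  (iter (N t) (flip p ((Num.sqrt (p * (1 - p)) * Num.sqrt t%:R)^-1))
     (fun y => (y <= b ki)%R%:R) 0
  - iter (N t) (flip p ((Num.sqrt (p * (1 - p)) * Num.sqrt t%:R)^-1))
     (fun y => (y <= a ki)%R%:R) 0)); last first.
  apply/funext => t; rewrite pr_block_box; apply: eq_bigr => ki _.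
  rewrite -!bexp_flip -bexpB; apply: eq_bexp => c _; rewrite add0r.
  set y := _ * _; have := ab ki => abk.
  have [ya|ya] := leP y (a ki); first by rewrite (le_trans ya abk)/= subrr.
  by rewrite subr0.
by apply: cvg_prod_seq => ki; apply: cvgB; exact: de_moivre_laplace.
Qed.

Lemma measurable_small_blocks n l :
  measurable [set w | small_blocks (coins w) p x m n l].
Proof.
rewrite (_ : [set _ | _] = \bigcap_k \bigcap_i \bigcap_j [set w | (k <= x)%N -> (i < m)%N ->
  (j <= n)%N -> `|walk (coins w) p k (n * i + j) - walk (coins w) p k (n * i)| <= l]).
  apply: bigcapT_measurable => k; apply: bigcapT_measurable => i.
  apply: bigcapT_measurable => j.
  have [kij|kij] := boolP [&& (k <= x)%N, (i < m)%N & (j <= n)%N]; last first.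
    rewrite (_ : [set _ | _] = setT)//; apply/seteqP; split => // w _ h1 h2 h3.
    by move: kij; rewrite h1 h2 h3.
  rewrite (_ : [set _ | _] = (fun w => walk (coins w) p k (n * i + j) - walk (coins w) p k (n * i))
    @^-1` `[- l, l]).
    rewrite -[X in measurable X]setTI.
    by apply: measurable_funB => //; exact: measurable_walk.
  apply/seteqP; split => w /=; rewrite in_itv/= -ler_norml; last by [].
  by case/and3P: kij => h1 h2 h3; apply.
apply/seteqP; split => w h.
  by move=> k _ i _ j _; exact: h.
by move=> k i j; exact: (h k Logic.I i Logic.I j Logic.I).
Qed.

(** Union bound over the (x+1)m blocks, each estimated by [bexp_hits] from the origin. *)
Lemma pr_small_blocks n l : 0 < l ->
  1 - pr P [set w | small_blocks (coins w) p x m n l] <=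
  (x.+1 * m)%:R * (8 * n%:R ^+ 2 / l ^+ 4).
Proof.
move=> l0; rewrite -prC; last exact: measurable_small_blocks.
pose A (ki : I) := [set w | hits p l 0 [seq X i w | i <- block n ki]].
have mA ki : measurable (A ki) by exact: (measurable_coins X _ (hits p l 0)).
have sub : ~` [set w | small_blocks (coins w) p x m n l] `<=`
    [set w | exists2 ki, ki \in enum {: I} & A ki w].
  move=> w /= nb; apply: contrapT => nA; apply: nb => k i j kx im jn.
  have nh : ~~ hits p l 0 [seq X i w | i <- block n (inord k, inord i)].
    apply/negP => hw; apply: nA; exists (inord k, inord i) => //.
    by rewrite mem_enum.
  have := hitsN nh (j := j); rewrite add0r /block/= !inordK// -map_take /site_block -map_take.
  rewrite take_iota (minn_idPl jn) size_map size_map size_iota => /(_ jn).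
  by rewrite -walk_centered.
apply: (le_trans (pr_le P _ _ sub)).
- by apply: measurableC; exact: measurable_small_blocks.
- by apply: measurable_exists.
apply: (le_trans (pr_exists_le P _)) => //.
apply: (@le_trans _ _ (\sum_(ki <- enum {: I}) (8 * n%:R ^+ 2 / l ^+ 4))); last first.
  by rewrite big_const_seq count_predT iter_addr_0 -cardE card_prod !card_ord -[leLHS]mulr_natl.
apply: ler_sum => ki _.
rewrite /pr /A (P_coins p01 lawX indX)//; last first.
  by rewrite /block map_inj_uniq ?iota_uniq// => a b [].
rewrite /block size_map size_iota; apply: (le_trans (bexp_hits p01 _ _ l0)).
by rewrite expr0n/= expr0n/= mulr0 !add0r.
Qed.

End WalkBlocks.

(** * Convergence in distribution *)

Section Assembly.
Context {R : realType} {d d' : measure_display}.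
Context {T : measurableType d} {T' : measurableType d'}.
Variables (P : probability T R) (P' : probability T' R) (p : R) (x : nat).
Variables (eps : nat -> nat -> {RV P >-> bool}) (B : 'I_x.+1 -> R -> T' -> R).
Hypothesis p01 : 0 < p < 1.
Hypothesis iid : iid_bernoulli p eps.
Hypothesis bmB : brownian_motion_dim P' B.

Let sigma : R := Num.sqrt (p * (1 - p)).

Let sigma0 : 0 < sigma.
Proof. by have /andP[p0 p1] := p01; rewrite sqrtr_gt0 mulr_gt0//; lra. Qed.

Let height t y (w : T) : \bar R := odb_height (coins eps w) t y.

Lemma measurable_height t y : measurable_fun setT (height t y).
Proof.
elim: t y => [|t IHt] y; first exact: measurable_cst.
have mc : measurable_fun setT (fun w => ((coins eps w t y)%:R%:E : \bar R)).
  apply/measurable_EFinP.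
  by have := @measurable_coin_fun _ _ _ P eps [:: (t, y)] (fun c => (head false c)%:R).
have ms : measurable_fun setT (fun w => height t y w + ((coins eps w t y)%:R)%:E)%E.
  exact: emeasurable_funD.
(* Measurability is read off the formula of the dynamics as a maximum, which has no case
   distinction. *)
have mx : measurable_fun setT (fun w => maxe (odb_left (odb_height (coins eps w) t) y)
    (height t y w + ((coins eps w t y)%:R)%:E)%E).
  apply: measurable_maxe => //; case: y {mc ms} => [|y] /=; last exact: IHt.
  exact: measurable_cst.
rewrite (_ : height t.+1 y = fun w => maxe (odb_left (odb_height (coins eps w) t) y)
    (height t y w + ((coins eps w t y)%:R)%:E)%E)//.
apply/funext => w; have := @odb_height_coin R (coins eps w) t y.
rewrite /height /= /odb_step; case: ifPn => [_|].
  by move=> h; rewrite max_l.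
rewrite -leNgt => hl _; rewrite max_r.
  by case: (coins eps w t y); rewrite ?mulr1n ?mulr0n ?adde0.
by apply: (le_trans hl); case: (coins eps w t y); rewrite ?mulr1n ?mulr0n ?adde0// leeDl.
Qed.

(** Clearing the denominator keeps extended real arithmetic out of the estimates; [scaled_le]
    restores the quotient when t > 0. *)
Let below (t : nat) (r : R) : set T :=
  [set w | (height t x w <= (p * t%:R + r * (sigma * Num.sqrt t%:R))%:E)%E].

Let measurable_below t r : measurable (below t r).
Proof.
rewrite (_ : below t r = height t x @^-1`
  `]-oo, (p * t%:R + r * (sigma * Num.sqrt t%:R))%:E]); last first.
  by apply/seteqP; split => w /=; rewrite in_itv.
by rewrite -[X in measurable X]setTI; apply: measurable_height => //; exact: emeasurable_itv.
Qed.

Section Grid.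
Variable m' : nat.
Local Notation m := m'.+1.
Local Notation I := ('I_x.+1 * 'I_m)%type.

Let E (z : I -> R) (r : R) :=
  grid_le x m (fun k i => \sum_(0 <= l < i) z (inord k, inord l)) r.

Lemma eq_grid_le (F G : nat -> nat -> R) r :
  (forall k i, (k <= x)%N -> (i <= m)%N -> F k i = G k i) ->
  grid_le x m F r -> grid_le x m G r.
Proof.
move=> FG gF; rewrite -[r]addr0 -(mulr0 (2 * x%:R + 1)).
by apply: (grid_le_dist _ _ gF) => // k i kx im; rewrite FG// subrr normr0.
Qed.

Lemma grid_leZ (F : nat -> nat -> R) a r : 0 < a ->
  grid_le x m (fun k i => a * F k i) (a * r) <-> grid_le x m F r.
Proof.
move=> a0.
have pZ tau : path_sum (fun k i => a * F k i) x tau = a * path_sum F x tau.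
  by elim: (x) => //= y ->; ring.
by split=> h tau ct tx; have := h tau ct tx; rewrite pZ ler_pM2l.
Qed.

(** Each grid value is a sum of at most [m] increments, and a path sum reads 2x + 1 grid values. *)
Let C : R := (2 * x%:R + 1) * m%:R.

Let C0 : 0 < C. Proof. by rewrite mulr_gt0// ltr_wpDl. Qed.

Let lipE z z' r eta : 0 < eta -> (forall i, `|z i - z' i| <= eta) ->
  E z r -> E z' (r + C * eta).
Proof.
move=> eta0 zz'; rewrite /C -mulrA; apply: grid_le_dist => // k i _ im.
rewrite -sumrB; apply: (le_trans (ler_norm_sum _ _ _)).
apply: (@le_trans _ _ (\sum_(0 <= l < i) eta)); first by apply: ler_sum.
rewrite big_const_nat iter_addr_0 subn0 -[leLHS]mulr_natl ler_wpM2r ?(ltW eta0)//.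
by rewrite ler_nat.
Qed.

Let L (t : nat) : R := sigma * Num.sqrt t%:R.
Let N (t : nat) : nat := ((t - x) %/ m)%N.
Let X t := block_increment (m' := m') (x := x) p eps (N t) (L t)^-1.
Let Z := increment (m' := m') B.

Let mEX t r : measurable [set w | E ((X t)^~ w) r].
Proof.
apply: (@measurable_grid_le _ _ _ (fun k i w => \sum_(0 <= l < i) X t (inord k, inord l) w)).
by move=> k i; apply: measurable_sum => l; exact: measurable_block_increment.
Qed.

Let mEZ r : measurable [set w | E (Z^~ w) r].
Proof.
apply: (@measurable_grid_le _ _ _ (fun k i w => \sum_(0 <= l < i) Z (inord k, inord l) w)).
by move=> k i; apply: measurable_sum => l; exact: measurable_increment bmB _.
Qed.

Let Nt t : (N t <= t)%N.
Proof. by apply: leq_trans (leq_div _ _) _; exact: leq_subr. Qed.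

Let Lcvg (c : R) : c / L t @[t --> \oo] --> (0 : R).
Proof.
rewrite (_ : (fun t => c / L t) = fun t => c / sigma * (Num.sqrt t%:R)^-1); last first.
  by apply/funext => t; rewrite /L invfM mulrA.
by rewrite -(mulr0 (c / sigma)); apply: cvgM; [exact: cvg_cst|exact: inv_sqrt_cvg0].
Qed.

Let bounds t : (x + m <= t)%N ->
  [/\ (0 < N t)%N, (N t * m + x <= t)%N & (t <= N t * m + x + m)%N].
Proof.
move=> xmt; have := divn_eq (t - x) m; have := ltn_pmod (t - x) (ltn0Sn m').
rewrite -/(N t) => h1 h2; split; [|lia|lia].
have : (m <= t - x)%N by lia.
by rewrite -(divn_gt0 _ (ltn0Sn m')).
Qed.

Let Ncvg : (N t)%:R / t%:R @[t --> \oo] --> (m%:R^-1 : R).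
Proof.
apply/cvgrPdist_le => e e0.
(* This product is (x + m) / t, written so that [Lcvg] gives its limit. *)
have h0 : sigma * (x + m)%:R / L t * (sigma / L t) @[t --> \oo] --> (0 * 0 : R).
  by apply: cvgM; exact: Lcvg.
rewrite mul0r in h0; move/cvgr0Pnorm_le : h0 => /(_ _ e0) h.
near=> t; have [|_ nt tn] := @bounds t; first by near: t; exact: nbhs_infty_ge.
have t0 : 0 < t%:R :> R by rewrite ltr0n; near: t; exact: nbhs_infty_gt.
have m0 : 0 < m%:R :> R by rewrite ltr0n.
apply: (@le_trans _ _ `|(sigma * (x + m)%:R) / L t * (sigma / L t)|); last by near: t.
rewrite (_ : sigma * (x + m)%:R / L t * (sigma / L t) = (x + m)%:R / t%:R); last first.
  have st : 0 < Num.sqrt t%:R :> R by rewrite sqrtr_gt0.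
  rewrite -[t%:R in RHS](sqr_sqrtr (ltW t0)) /L; field; by rewrite !gt_eqF.
rewrite [X in `|X|](_ : _ = (t%:R - (N t * m)%:R) / t%:R / m%:R); last first.
  by rewrite natrM; field; rewrite !gt_eqF.
have d0 : 0 <= t%:R - (N t * m)%:R :> R by rewrite subr_ge0 ler_nat; lia.
have d1 : t%:R - (N t * m)%:R <= (x + m)%:R :> R.
  by rewrite lerBlDr -natrD ler_nat; lia.
have xt0 : 0 <= (x + m)%:R / t%:R :> R by rewrite divr_ge0.
have dt0 : 0 <= (t%:R - (N t * m)%:R) / t%:R :> R by rewrite divr_ge0// ltW.
rewrite !ger0_norm//; last by rewrite divr_ge0.
apply: (@le_trans _ _ ((t%:R - (N t * m)%:R) / t%:R)).
  by rewrite ler_pdivrMr// ler_peMr// ler1n.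
by rewrite ler_pM2r// invr_gt0.
Unshelve. all: by end_near. Qed.

Let boxcvg (del r : R) : 0 < del -> \forall t \near \oo,
  pr P [set w | E ((X t)^~ w) r] <= pr P' [set w | E (Z^~ w) (r + del)] + del /\
  pr P' [set w | E (Z^~ w) r] <= pr P [set w | E ((X t)^~ w) (r + del)] + del.
Proof.
move=> del0.
apply: (@box_convergence R I d d' T T' P P' X Z _ _ _ C E C0 lipE mEX mEZ r del del0).
- by move=> t ki; exact: measurable_block_increment.
- by move=> ki; exact: measurable_increment bmB _.
move=> a b ab; rewrite (pr_increment_box bmB ab).
exact: (pr_block_box_cvg p01 iid Nt Ncvg ab).
Qed.

Let E_walk t w r : 0 < L t -> E ((X t)^~ w) r <->
  grid_le x m (fun k i => walk (coins eps w) p k (N t * i)) (r * L t).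
Proof.
move=> L0; have Li0 : 0 < (L t)^-1 by rewrite invr_gt0.
rewrite -(grid_leZ _ _ Li0) mulrC mulfK ?gt_eqF//.
by split; apply: eq_grid_le => k i kx im; rewrite block_increment_sum.
Qed.

Let Dosc (del : R) : R := (x.+1)%:R * 8 / (del * sigma) ^+ 4.

(** The discrepancies that do not depend on [t] are negligible against [L t] and are absorbed in the
    shift of [r]. Only the second inequality passes from the grid to all times, so only it pays for
    oscillations inside blocks. *)
Lemma grid_sandwich (del r : R) : 0 < del -> \forall t \near \oo,
  pr P (below t r) <= pr P' [set w | E (Z^~ w) (r + del)] + del /\
  pr P' [set w | E (Z^~ w) r] <= pr P (below t (r + del)) + del +
    Dosc (del / 4 / (2 * x%:R + 1)) / m%:R.
Proof.
move=> del0; have del2 : 0 < del / 2 by rewrite divr_gt0.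
have del4 : 0 < del / 4 by rewrite divr_gt0.
have x21 : 0 < 2 * x%:R + 1 :> R by rewrite ltr_wpDl.
(* Budget for the shift: del/2 for the boxes, del/4 for the oscillations since (2x + 1) l = del/4,
   and del/4 for [c2]. *)
pose l := del / 4 / (2 * x%:R + 1).
have l0 : 0 < l by rewrite divr_gt0.
pose c1 : R := x%:R ^+ 2 + m%:R + x%:R.
pose c2 : R := (2 * x%:R + 1) * (m%:R + x%:R).
have h1 : \forall t \near \oo, `|c1 / L t| <= del / 2.
  by have /cvgr0Pnorm_le := Lcvg c1; apply.
have h2 : \forall t \near \oo, `|c2 / L t| <= del / 4.
  by have /cvgr0Pnorm_le := Lcvg c2; apply.
have b1 := boxcvg (r + del / 2) del2.
have b2 := boxcvg r del2.
near=> t.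
have xmt : (x + m <= t)%N by near: t; exact: nbhs_infty_ge.
have t0 : 0 < t%:R :> R by rewrite ltr0n; apply: leq_trans xmt; rewrite addnS.
have L0 : 0 < L t by rewrite mulr_gt0// sqrtr_gt0.
have [n0 nt tn] := bounds xmt.
have ht1 : `|c1 / L t| <= del / 2 by near: t.
have ht2 : `|c2 / L t| <= del / 4 by near: t.
have bt1 : pr P [set w | E ((X t)^~ w) (r + del / 2)] <=
    pr P' [set w | E (Z^~ w) (r + del / 2 + del / 2)] + del / 2 /\
  pr P' [set w | E (Z^~ w) (r + del / 2)] <=
    pr P [set w | E ((X t)^~ w) (r + del / 2 + del / 2)] + del / 2 by near: t.
have bt2 : pr P [set w | E ((X t)^~ w) r] <=
    pr P' [set w | E (Z^~ w) (r + del / 2)] + del / 2 /\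
  pr P' [set w | E (Z^~ w) r] <=
    pr P [set w | E ((X t)^~ w) (r + del / 2)] + del / 2 by near: t.
have {}ht1 : c1 <= del / 2 * L t.
  by rewrite -ler_pdivrMr//; apply: le_trans ht1; exact: ler_norm.
have {}ht2 : c2 <= del / 4 * L t.
  by rewrite -ler_pdivrMr//; apply: le_trans ht2; exact: ler_norm.
have grid_mono w s s' : s <= s' ->
    grid_le x m (fun k i => walk (coins eps w) p k (N t * i)) s ->
    grid_le x m (fun k i => walk (coins eps w) p k (N t * i)) s'.
  by move=> ss h tau ct tx; apply: le_trans ss; exact: h.
split.
  have [+ _] := bt1; rewrite -addrA -splitr => b.
  have : pr P (below t r) <= pr P [set w | E ((X t)^~ w) (r + del / 2)].
    apply: pr_le => // w bw; apply/E_walk => //.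
    have := grid_le_of_height p01 nt tn bw; apply: grid_mono.
    by rewrite -/(L t); move: ht1; rewrite /c1; move: (L t) => u; lra.
  lra.
have [_ b] := bt2.
pose S := [set w | small_blocks (coins eps w) p x m (N t) (l * L t)].
have mS : measurable S by exact: measurable_small_blocks.
have lL0 : 0 < l * L t by rewrite mulr_gt0.
have : pr P [set w | E ((X t)^~ w) (r + del / 2)] <= pr P (below t (r + del)) + (1 - pr P S).
  rewrite -prC//; apply: le_trans (prU_le P _ _) => //; last exact: measurableC.
  apply: pr_le => //; first by apply: measurableU => //; exact: measurableC.
  move=> w /E_walk - /(_ L0) gw; have [Sw|Sw] := pselect (S w); last by right.
  left; rewrite /below/=.
  have := height_of_grid_le p01 (ltn0Sn m') n0 nt tn Sw (ltW lL0) gw.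
  move=> /le_trans; apply; rewrite lee_fin lerD2l.
  have -> : (2 * x%:R + 1) * (l * L t + m%:R + x%:R) = del / 4 * L t + c2.
    by rewrite /l /c2; field; rewrite gt_eqF.
  rewrite -/(L t); move: ht2; move: (c2) (L t) => u1 u2; lra.
have : 1 - pr P S <= Dosc l / m%:R.
  apply: (le_trans (pr_small_blocks p01 iid x m' (N t) lL0)).
  have A0 : 0 <= x.+1%:R * 8 / (l * sigma) ^+ 4.
    apply: divr_ge0; [exact: mulr_ge0|].
    by apply: exprn_ge0; rewrite mulr_ge0 ?(ltW l0) ?(ltW sigma0).
  (* The level [l * L t] turns the union bound into a constant times m (N t)^2 / t^2, and N t * m <=
     t leaves 1/m. *)
  rewrite (_ : _ * _ = x.+1%:R * 8 / (l * sigma) ^+ 4 *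
    (m%:R * (N t)%:R ^+ 2 / t%:R ^+ 2)); last first.
    rewrite -[t%:R in RHS](sqr_sqrtr (ltW t0)) /L natrM; field.
    by rewrite !gt_eqF// sqrtr_gt0.
  rewrite /Dosc; apply: ler_wpM2l => //.
  rewrite ler_pdivrMr ?exprn_gt0// ler_pdivlMl ?ltr0n//.
  have -> : m%:R * (m%:R * (N t)%:R ^+ 2) = (N t * m)%:R ^+ 2 :> R by rewrite natrM; ring.
  by rewrite lerXn2r ?nnegrE// ler_nat; apply: leq_trans nt; exact: leq_addr.
  rewrite -/l; move: (Dosc l / m%:R) => u; lra.
Unshelve. all: by end_near. Qed.

Lemma increment_dyadic j r : m = (2 ^ j)%N ->
  [set w | E (Z^~ w) r] = dyadic_grid B j r.
Proof.
move=> mE; rewrite /dyadic_grid -mE.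
by apply/seteqP; split => w; apply: eq_grid_le => k i _ im;
  rewrite (increment_sum bmB).
Qed.

End Grid.

Let D (del : R) : R := (x.+1)%:R * 8 / (del / 4 / (2 * x%:R + 1) * sigma) ^+ 4.

Lemma dyadic_sandwich j (del r : R) : 0 < del -> \forall t \near \oo,
  pr P (below t r) <= pr P' (dyadic_grid B j (r + del)) + del /\
  pr P' (dyadic_grid B j r) <= pr P (below t (r + del)) + del + D del / (2 ^ j)%:R.
Proof.
move=> del0; have mE : (2 ^ j).-1.+1 = (2 ^ j)%N by rewrite prednK// expn_gt0.
by have := grid_sandwich (2 ^ j).-1 r del0; rewrite !(increment_dyadic _ mE) mE.
Qed.

Let maxle (r : R) : set T' := [set w | brownian_max B w <= r].

Let measurable_maxle r : measurable (maxle r).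
Proof.
rewrite /maxle (brownian_max_grid bmB); apply: bigcapT_measurable => j.
exact: measurable_dyadic_grid bmB _ _.
Qed.

Lemma measurable_brownian_max : measurable_fun setT (brownian_max B).
Proof.
apply: (measurability (@RGenOInfty.G R)) => [|_ [_ [r ->] <-]].
  exact: RGenOInfty.measurableE.
rewrite setTI (_ : _ @^-1` _ = ~` maxle r); first exact: measurableC.
by apply/seteqP; split => w /=; rewrite in_itv/= andbT /maxle/= ltNge => /negP.
Qed.

Let dyadic_cvg r : pr P' (dyadic_grid B j r) @[j --> \oo] --> pr P' (maxle r).
Proof.
rewrite /maxle (brownian_max_grid bmB); apply: fine_cvg; rewrite fineK; last first.
  apply: fin_num_measure; apply: bigcapT_measurable => j.
  exact: measurable_dyadic_grid bmB _ _.
apply: nonincreasing_cvg_mu.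
- by rewrite (le_lt_trans (probability_le1 _ _)) ?ltry//; exact: measurable_dyadic_grid bmB _ _.
- by move=> j; exact: measurable_dyadic_grid bmB _ _.
- by apply: bigcapT_measurable => j; exact: measurable_dyadic_grid bmB _ _.
- apply/nonincreasing_seqP => j; apply/subsetPset; exact: dyadic_gridS.
Qed.

(** The upper bound needs the dyadic probabilities to be close to their limit; the lower bound needs
    only the inclusion of [maxle] in every dyadic event. *)
Lemma below_cvg r : {for r, continuous (fun s => P' (maxle s))} ->
  pr P (below t r) @[t --> \oo] --> pr P' (maxle r).
Proof.
move=> cr.
have {}cr : pr P' (maxle s) @[s --> r] --> pr P' (maxle r).
  by apply: fine_cvg; rewrite fineK ?fin_num_measure//; exact: cr.
apply/cvgrPdist_le => e e0; have e30 : 0 < e / 3 by rewrite divr_gt0.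
have [del [del0 dele c1 c2]] : exists del : R, [/\ 0 < del, del <= e / 3,
    pr P' (maxle (r + del)) <= pr P' (maxle r) + e / 3 &
    pr P' (maxle r) - e / 3 <= pr P' (maxle (r - del))].
  move/cvgrPdist_le : cr => /(_ _ e30) [u /= u0 hu].
  have hd : 0 < Num.min (u / 2) (e / 3) by rewrite lt_min divr_gt0.
  exists (Num.min (u / 2) (e / 3)); split => //; first by rewrite ge_min lexx orbT.
    have := hu (r + Num.min (u / 2) (e / 3)).
    rewrite /ball_/= opprD addNKr normrN gtr0_norm// => /(_ _)/ler_normlP[].
      by rewrite gt_min; apply/orP; left; lra.
    by move=> ? ?; lra.
  have := hu (r - Num.min (u / 2) (e / 3)).
  rewrite /ball_/= opprB subrKC gtr0_norm// => /(_ _)/ler_normlP[].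
    by rewrite gt_min; apply/orP; left; lra.
  by move=> ? ?; lra.
(* The grid is chosen after [del], because [D del] grows like del^(-4) as [del] shrinks. *)
have [j [j1 j2]] : exists j, pr P' (dyadic_grid B j (r + del)) <= pr P' (maxle (r + del)) + e / 3
    /\ D del / (2 ^ j)%:R <= e / 3.
  have /cvgrPdist_le/(_ _ e30) h1 := @dyadic_cvg (r + del).
  have h2 : D del * (1 / 2) ^+ j @[j --> \oo] --> (0 : R).
    by apply: cvg_geometric; rewrite ger0_norm; lra.
  move/cvgr0Pnorm_le : h2 => /(_ _ e30) h2.
  near \oo => j; exists j; split.
    have : `|pr P' (maxle (r + del)) - pr P' (dyadic_grid B j (r + del))| <= e / 3 by near: j.
    by rewrite ler_norml; lra.
  have : `|D del * (1 / 2) ^+ j| <= e / 3 by near: j.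
  rewrite mul1r exprVn natrX; apply: le_trans; exact: ler_norm.
have maxle_sub s : pr P' (maxle s) <= pr P' (dyadic_grid B j s).
  apply: pr_le => //; first exact: measurable_dyadic_grid bmB _ _.
  by rewrite /maxle (brownian_max_grid bmB); exact: bigcap_inf.
have s1 := dyadic_sandwich j r del0; have s2 := dyadic_sandwich j (r - del) del0.
near=> t.
have [t1 _] : pr P (below t r) <= pr P' (dyadic_grid B j (r + del)) + del /\
  pr P' (dyadic_grid B j r) <= pr P (below t (r + del)) + del + D del / (2 ^ j)%:R by near: t.
have [_ t2] : pr P (below t (r - del)) <= pr P' (dyadic_grid B j (r - del + del)) + del /\
  pr P' (dyadic_grid B j (r - del)) <= pr P (below t (r - del + del)) + del +
    D del / (2 ^ j)%:R by near: t.
rewrite subrK in t2; have := maxle_sub (r - del).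
by rewrite ler_norml => ?; apply/andP; split; lra.
Unshelve. all: by end_near. Qed.

Let scaled_le (y : \bar R) (c l r : R) : 0 < l ->
  ((y - c%:E) * (l^-1)%:E <= r%:E)%E = (y <= (c + r * l)%:E)%E.
Proof.
move=> l0; case: y => [y| |].
- by rewrite -EFinB -EFinM !lee_fin ler_pdivrMr// lerBlDl.
- by rewrite addye// gt0_mulye// lte_fin invr_gt0.
- by rewrite addNye gt0_mulNye ?lte_fin ?invr_gt0// !leNye.
Qed.

Lemma height_cvg_in_distribution :
  cvg_in_distribution P
    (fun t w => ((height t x w - (p * t%:R)%:E) * ((sigma * Num.sqrt t%:R)^-1)%:E)%E)
    P' (brownian_max B).
Proof.
split.
- move=> t; apply: emeasurable_funM => //; apply: emeasurable_funB => //.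
  exact: measurable_height.
- exact: measurable_brownian_max.
move=> r cr.
have h : (pr P (below t r))%:E @[t --> \oo] --> P' [set w | brownian_max B w <= r].
  rewrite (prE P' (measurable_maxle r)).
  by apply: cvg_EFin; [near=> t|exact: below_cvg].
(* Only large [t] matter: at t = 0 the scaling factor is the inverse of 0. *)
apply: cvg_trans h; apply: near_eq_cvg; near=> t.
have t0 : 0 < t%:R :> R by rewrite ltr0n; near: t; exact: nbhs_infty_gt.
have L0 : 0 < sigma * Num.sqrt t%:R by rewrite mulr_gt0// sqrtr_gt0.
rewrite -prE//; congr (P _); apply/seteqP; split => w /=;
  by rewrite scaled_le.
Unshelve. all: by end_near. Qed.

End Assembly.

Theorem mainTheorem5 (R : realType)
    (d : measure_display) (T : measurableType d) (P : probability T R)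
    (d' : measure_display) (T' : measurableType d') (P' : probability T' R)
    (p : R) (x : nat)
    (eps : nat -> nat -> {RV P >-> bool}) (B : 'I_x.+1 -> R -> T' -> R) :
  0 < p < 1 ->
  iid_bernoulli p eps ->
  brownian_motion_dim P' B ->
  let sigma := Num.sqrt (p * (1 - p)) in
  let h (t y : nat) (w : T) : \bar R := odb_height (fun s z => eps s z w) t y in
  cvg_in_distribution
    P (fun t w => ((h t x w - (p * t%:R)%:E) *
                   ((sigma * Num.sqrt t%:R)^-1)%:E)%E)
    P' (brownian_max B).
Proof. by move=> p01 iid bmB sigma h; exact: height_cvg_in_distribution. Qed.
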